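(* Let $\{Z_n\}_{n\in\mathbb{N}_0}$ be a defective Galton-Watson process in a varying environment $v=\{f_n\}_{n\in\mathbb{N}}$. Assume that there exists a constant $c>0$ such that for all $n\in\mathbb{N}$, $$E[X_{n1}^2; X_{n1}\ge 2] \le c\, E[X_{n1}; X_{n1} \ge 2].$$ Then for any $\rho\in(0,1)$ and $n_0\in\mathbb{N}$ such that $f_n(\rho)\ge\rho$ for all $n\ge n_0$ we have $$\liminf_{n\to \infty} \frac{ E[Z_n]}{\mu_n( \rho)} >0 \quad \text{and}\quad \liminf_{n \to \infty} \nu_n( \rho) P[\tau_a >n] >0 .$$ If, in addition, $\inf_{n \ge 1}\delta_n>0$ and $\inf_{n \ge 1} f_n''( \rho)>0$, then for any $\sigma\in(\rho,1)$ such that $f_n(\sigma)\le\sigma$ for all $n\ge n_0$, and for any $\varepsilon>0$ with $\sigma+\varepsilon\le 1$, we have $$\limsup_{n\to \infty} \frac{ E[Z_n] }{\mu_n( \sigma+ \varepsilon)}< \infty \quad \text{and}\quad \limsup_{n \to \infty} \nu_n( \sigma+ \varepsilon) P[\tau_a >n] <\infty .$$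
   Context: $\mathbb{N}=\{1,2,\dots\}$, $\mathbb{N}_0=\mathbb{N}\cup\{0\}$, $\Delta\notin\mathbb{N}_0$ is an extra ''graveyard'' state, and $\mathbb{N}_\Delta=\mathbb{N}_0\cup\{\Delta\}$. For each $n\in\mathbb{N}$, $f_n$ is a possibly defective distribution on $\mathbb{N}_0$: weights $f_n[k]\ge 0$, $k\in\mathbb{N}_0$, with $\sum_k f_n[k]\le 1$; its generating function is also denoted $f_n(s)=\sum_{k\ge0}f_n[k]s^k$, $s\in[0,1]$ (derivatives at $1$ are the corresponding sums, e.g. $f_n'(1)=\sum_k kf_n[k]$). Standing assumption: $0<f_n'(1)<\infty$ for all $n\ge1$. A defective Galton-Watson process in a varying environment $v=\{f_n\}_{n\in\mathbb{N}}$ is the process defined by $Z_0=1$, $Z_n=\sum_{j=1}^{Z_{n-1}}X_{nj}$, $n\in\mathbb{N}$, where $\{X_{nj}:n,j\in\mathbb{N}\}$ are independent $\mathbb{N}_\Delta$-valued random variables with $P[X_{nj}=k]=f_n[k]$ for $k\in\mathbb{N}_0$ and $P[X_{nj}=\Delta]=1-f_n(1)$. Conventions: $\Delta+k=\Delta$ for $k\in\mathbb{N}_\Delta$, and $\sum_{j=1}^{\Delta}k_j=\Delta$; empty sums are $0$. Thus $0$ and $\Delta$ are absorbing. For an $\mathbb{N}_\Delta$-valued $X$, $E[h(X)]$ means $E[h(X);X\ne\Delta]$, and events such as $\{X\ge 2\}$ do not include $X=\Delta$. Notation: $\delta_n=1-f_n(1)$; for $0<s\le1$, $\mu_n(s)=\prod_{i=1}^n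 f_i'(s)$ and $\nu_n(s)=\sum_{i=1}^n \frac{1}{\mu_i(s)}$; $\tau_0=\min\{n\in\mathbb{N}:Z_n=0\}$, $\tau_\Delta=\min\{n\in\mathbb{N}:Z_n=\Delta\}$ (with $\min\varnothing=\infty$), $\tau_a=\tau_0\wedge\tau_\Delta$. *)

(* Defs.v *)
From HB Require Import structures.
From mathcomp Require Import all_boot all_order all_algebra finmap.
From mathcomp Require Import all_classical all_reals all_analysis.
From mathcomp Require Import ring lra.

Set Implicit Arguments.
Unset Strict Implicit.
Unset Printing Implicit Defensive.

Import Order.TTheory GRing.Theory Num.Theory.
Import numFieldNormedType.Exports.

Local Open Scope classical_set_scope.
Local Open Scope ring_scope.

(* The state space N_0 together with the graveyard state [None], equipped with
   the discrete sigma-algebra. *)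
Definition natD : Type := option nat.

HB.instance Definition _ := Pointed.on natD.
HB.instance Definition _ := @isMeasurable.Build default_measure_display natD
  discrete_measurable discrete_measurable0
  discrete_measurableC discrete_measurableU.

Definition Delta : natD := None.

Definition addD (x y : natD) : natD :=
  if (x, y) is (Some m, Some n) then Some (m + n)%N else Delta.

Section GeneratingFunctions.
Variable R : realType.
Implicit Types (f : nat -> R) (s : R).

Definition defective_distribution f : Prop :=
  (forall k, 0 <= f k) /\ (\sum_(0 <= k <oo) (f k)%:E <= 1)%E.

(* f(s) is the sum of f[k] s^k; its derivatives on [0, 1] are taken as
   the termwise differentiated series, which also covers the endpoint s = 1.
   [is_derive_genf] and [is_derive_dgenf] below show that they are the
   derivatives for |s| < 1. *)
Definition genf f s : R := limn (pseries f s).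

Definition dgenf f s : R := genf (pseries_diffs f) s.

Definition d2genf f s : R := dgenf (pseries_diffs f) s.

(* f'(1), possibly infinite; see [dgenf1E]. *)
Definition mean f : \bar R := (\sum_(0 <= k <oo) (k%:R * f k)%:E)%E.

End GeneratingFunctions.

Section GeneratingFunctionsFacts.
Variable R : realType.
Implicit Types (f c : nat -> R) (s : R).

Let cvg_pseries_diffs c s :
  (forall x, `|x| < 1 -> cvgn (pseries (fun k => `|c k|) x)) -> `|s| < 1 ->
  cvgn (pseries (fun k => `|pseries_diffs c k|) s).
Proof.
move=> cvgc s1; pose e : R := (1 - `|s|) / 2; pose q := `|s| + e.
have e0 : 0 < e by rewrite divr_gt0// subr_gt0.
have q0 : 0 <= q by rewrite addr_ge0// ltW.
have q1 : `|q| < 1 by rewrite ger0_norm// /q /e; lra.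
have bern i : i.+1%:R * `|s| ^+ i <= q ^+ i.+1 / e.
  rewrite ler_pdivlMr//; elim: i => [|i IH]; first by rewrite expr1 mul1r mul1r lerDr.
  rewrite [in leRHS]exprS; apply: (@le_trans _ _ (`|s| * q ^+ i.+1 + e * `|s| ^+ i.+1)).
    rewrite -natr1 exprS.
    have -> : (i.+1%:R + 1) * (`|s| * `|s| ^+ i) * e =
      `|s| * (i.+1%:R * `|s| ^+ i * e) + e * (`|s| * `|s| ^+ i) by ring.
    by rewrite lerD2r ler_wpM2l.
  rewrite (mulrDl `|s| e (q ^+ i.+1)) lerD2l ler_wpM2l ?(ltW e0)//.
  by rewrite lerXn2r ?nnegrE// /q lerDl ltW.
apply: normed_cvg.
have cvgq : cvgn (series (fun i => `|c i.+1| * q ^+ i.+1 / e)).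
  rewrite (_ : series _ = (fun n => (pseries (fun k => `|c k|) q n.+1 - `|c 0%N|) / e)).
    apply: is_cvgM; last exact: is_cvg_cst.
    apply: is_cvgB; last exact: is_cvg_cst.
    by have /cvg_ex[l hl] := cvgc _ q1; apply/cvg_ex; exists l; rewrite (cvg_shiftS (pseries _ q)).
  apply/funext => n; rewrite /pseries /series/= -mulr_suml big_nat_recl//=.
  by rewrite expr0 mulr1 addrC addKr.
apply: (series_le_cvg _ _ _ cvgq) => i /=; first exact: normr_ge0.
  by rewrite divr_ge0 ?(ltW e0)// mulr_ge0// exprn_ge0.
rewrite /pseries_diffs !normrM !normr_id normrX (ger0_norm (ler0n _ _)).
by rewrite mulrAC mulrC -[leRHS]mulrA ler_wpM2l.
Qed.

Let cvg_pseries_normK c s : cvgn (pseries (fun k => `|c k|) `|s|) ->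
  cvgn (pseries c s).
Proof.
move=> h; apply: normed_cvg; rewrite /normed_series_of /=.
rewrite (_ : (fun _ => _) = (fun i => `|c i| * `|s| ^+ i))//.
by apply/funext => i; rewrite normrM normrX.
Qed.

Let is_derive_pseries c s :
  (forall x, `|x| < 1 -> cvgn (pseries (fun k => `|c k|) x)) -> `|s| < 1 ->
  is_derive s (1 : R) (genf c) (dgenf c s).
Proof.
move=> cvgc s1; pose K : R := (1 + `|s|) / 2.
have K0 : 0 <= K by rewrite divr_ge0// addr_ge0.
have K1 : `|K| < 1 by rewrite ger0_norm// /K; lra.
have cvg1 := fun x => @cvg_pseries_diffs c x cvgc.
have cvg2 := fun x => @cvg_pseries_diffs (pseries_diffs c) x cvg1.
apply: (@pseries_snd_diffs _ _ K); first by apply/cvg_pseries_normK/cvgc; rewrite normr_id.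
- by apply/cvg_pseries_normK/cvg1; rewrite normr_id.
- by apply/cvg_pseries_normK/cvg2; rewrite normr_id.
- by rewrite (ger0_norm K0) /K; lra.
Qed.

Let cvg_genf f s : defective_distribution f -> `|s| < 1 ->
  cvgn (pseries (fun k => `|f k|) s).
Proof.
move=> [f0 f1] s1; apply: (@is_cvg_pseries_inside _ _ 1); last by rewrite normr1.
apply: nondecreasing_is_cvgn.
  apply/nondecreasing_seqP => n; rewrite /pseries /series/= big_nat_recr//=.
  by rewrite lerDl expr1n mulr1.
exists 1 => _ [n _ <-]; rewrite -lee_fin; apply: le_trans f1.
rewrite /pseries /series/= -sumEFin.
under eq_bigr do rewrite expr1n mulr1 ger0_norm//.
by apply: nneseries_lim_ge => k _ _; rewrite lee_fin.
Qed.

Lemma is_derive_genf f s : defective_distribution f -> `|s| < 1 ->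
  is_derive s (1 : R) (genf f) (dgenf f s).
Proof. by move=> df; apply: is_derive_pseries => x; exact: cvg_genf. Qed.

Lemma is_derive_dgenf f s : defective_distribution f -> `|s| < 1 ->
  is_derive s (1 : R) (dgenf f) (d2genf f s).
Proof.
move=> df; apply: is_derive_pseries => x; apply: cvg_pseries_diffs => y.
exact: cvg_genf.
Qed.

Lemma dgenf1E f : (forall k, 0 <= f k) -> (mean f < +oo)%E ->
  (dgenf f 1)%:E = mean f.
Proof.
move=> f0 fm.
have h : mean f = (\sum_(0 <= k <oo) (pseries_diffs f k)%:E)%E.
  rewrite /mean nneseries_recl//; last by move=> k _; rewrite lee_fin mulr_ge0.
  rewrite mul0r add0e -(@nneseries_addn _ (fun k => (k%:R * f k)%:E) 1)//.
    by apply: eq_eseriesr => k _; rewrite addn1.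
  by move=> k; rewrite lee_fin mulr_ge0.
rewrite h in fm *; rewrite /dgenf /genf.
have d0 k : 0 <= pseries_diffs f k by rewrite mulr_ge0.
have E n : (\sum_(0 <= k < n) (pseries_diffs f k)%:E)%E =
    (pseries (pseries_diffs f) 1 n)%:E.
  by rewrite sumEFin /pseries /series/=; congr EFin; apply: eq_bigr => k _; rewrite expr1n mulr1.
rewrite -EFin_lim; first by congr (limn _); apply/funext => n; rewrite E.
apply: nondecreasing_is_cvgn.
  apply/nondecreasing_seqP => n; rewrite /pseries /series/= big_nat_recr//=.
  by rewrite lerDl expr1n mulr1.
have S0 : (0 <= \sum_(0 <= k <oo) (pseries_diffs f k)%:E)%E.
  by apply: nneseries_ge0 => k _ _; rewrite lee_fin.
exists (fine (\sum_(0 <= k <oo) (pseries_diffs f k)%:E)%E) => _ [n _ <-].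
rewrite -lee_fin fineK ?ge0_fin_numE// -E.
by apply: nneseries_lim_ge => k _ _; rewrite lee_fin.
Qed.

End GeneratingFunctionsFacts.

Section Environment.
Variables (R : realType) (f : nat -> nat -> R).

Definition delta (n : nat) : R := 1 - genf (f n) 1.

Definition mu (n : nat) (s : R) : R := \prod_(1 <= i < n.+1) dgenf (f i) s.

Definition nu (n : nat) (s : R) : R := \sum_(1 <= i < n.+1) (mu i s)^-1.

End Environment.

Section Process.
Context {d : measure_display} {T : measurableType d} {R : realType}.
Variable P : probability T R.

(* E[h(X); X \in A] for A a set of natural numbers, so X <> Delta on the
   event; the default value 0 in [odflt] is never used. *)
Definition expectD (X : T -> natD) (h : nat -> R) (A : set nat) : \bar R :=
  (\int[P]_(w in X @^-1` (Some @` A)) (h (odflt 0%N (X w)))%:E)%E.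

Definition independent_family {d' : measure_display} {E : measurableType d'}
    {I : choiceType} (D : set I) (X : I -> T -> E) : Prop :=
  forall J : {fset I}, [set` J] `<=` D ->
  forall A : I -> set E, (forall i, measurable (A i)) ->
  P (\bigcap_(i in [set` J]) (X i @^-1` A i)) =
  (\prod_(i <- J) P (X i @^-1` A i))%E.

(* Only indices n, j >= 1 are relevant for f n, X n j. *)
Definition offspring_variables (f : nat -> nat -> R)
    (X : nat -> nat -> {RV P >-> natD}) : Prop :=
  [/\ independent_family [set nj : nat * nat | (0 < nj.1)%N /\ (0 < nj.2)%N]
        (fun nj => X nj.1 nj.2),
      forall n j, (0 < n)%N -> (0 < j)%N ->
        forall k, P (X n j @^-1` [set Some k]) = (f n k)%:E &
      forall n j, (0 < n)%N -> (0 < j)%N ->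
        P (X n j @^-1` [set Delta]) = (1 - genf (f n) 1)%:E].

End Process.

Section GaltonWatson.
Context {T : Type} {R : realType}.
Variable X : nat -> nat -> T -> natD.

Fixpoint GW (n : nat) (w : T) : natD :=
  if n is m.+1 then
    if GW m w is Some z then
      \big[addD/Some 0%N]_(1 <= j < z.+1) X n j w
    else Delta
  else Some 1%N.

(* First hitting time of a; +oo if there is none. *)
Definition hitting_time (Z : nat -> T -> natD) (a : natD) (w : T) : \bar R :=
  ereal_inf [set (n%:R)%:E | n in [set n | (0 < n)%N /\ Z n w = a]].

Definition absorption_time (Z : nat -> T -> natD) (w : T) : \bar R :=
  mine (hitting_time Z (Some 0%N) w) (hitting_time Z Delta w).

End GaltonWatson.

(* Main.v *)
(** Write F_(i,n) for the composition of f_(i+1), ..., f_n. Then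
    E[Z_n] is the product over i <= n of f_i'(F_(i,n)(1)), and
    P[tau_a > n] = F_(0,n)(1) - F_(0,n)(0).

    Put d_i = F_(i,n)(1) - F_(i,n)(0) and A_i = f_i'(F_(i,n)(1)). The moment
    condition gives Kersting-type shape bounds
      1 / d_(i-1) <= (1 / d_i + C) / A_i,
    and, when f_i''(rho) and delta_i are bounded below, also the reverse
    inequality with another constant, so that 1 / P[tau_a > n] is comparable
    to the sum over i <= n of 1 / (A_1 ... A_i).

    Finally F_(i,n)(1) >= rho for i + 1 >= n0, while f_i(1) <= 1 - delta makes
    f_i a contraction above sigma, so F_(i,n)(1) <= sigma + eps once n - i is
    large. Hence A_i lies between f_i'(rho) and f_i'(sigma + eps) for all but
    boundedly many i; each exceptional factor costs at most a constant, because
    g^M f_i'(1) <= f_i'(g) by the moment condition. *)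
Require Import Defs.
From HB Require Import structures.
From mathcomp Require Import all_boot all_order all_algebra finmap.
From mathcomp Require Import all_classical all_reals all_analysis.
From mathcomp Require Import measurable_realfun ring lra zify.

Set Implicit Arguments.
Unset Strict Implicit.
Unset Printing Implicit Defensive.

Import Order.TTheory GRing.Theory Num.Theory.
Import numFieldNormedType.Exports.

Local Open Scope classical_set_scope.
Local Open Scope ring_scope.

(** The moment condition is a statement at s = 1, whereas defectiveness pushes the points F_(i,n)(1)
    below 1, to places that depend on n. Evaluating at such a point g amounts to reweighting f[k] by
    g^k. The condition survives this, because k - M changes sign only at M while g^k decreases in k:
    replacing g^k by g^M can only increase the sum of k (k - M) g^k f[k] over k >= 2. It is
    therefore kept as the single sign [t <= 0]. The inequalities that use it come from an inequality
    between powers for each fixed k, containing a multiple of k (k - M), which is summed against f;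
    the coefficient of that multiple has the sign that lets [t] be discarded. The shape bounds are
    thus proved between two arbitrary points h <= g, not by an expansion at 1. For the process, no
    conditional expectation is formed: the population size and the number of summands already added
    are tracked separately, and independence is a product formula for single events. *)

Section WeightedSums.
Variable R : realType.
Implicit Types (f h : nat -> R) (s : R).

(** Value and convergence are carried together, so that linear combinations and comparisons of
    series raise no separate summability conditions. *)
Definition wsum f h (l : R) : Prop := series (fun k => f k * h k) @ \oo --> l.

Lemma wsum_lin f h1 h2 l1 l2 (a b : R) : wsum f h1 l1 -> wsum f h2 l2 ->
  wsum f (fun k => a * h1 k + b * h2 k) (a * l1 + b * l2).
Proof.
move=> H1 H2; rewrite /wsum.
rewrite (_ : series _ = (fun n => a * series (fun k => f k * h1 k) n +
    b * series (fun k => f k * h2 k) n)).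
  by apply: cvgD; apply: cvgMr.
apply/funext => n; rewrite /series/= !mulr_sumr -big_split/=.
by apply: eq_bigr => k _; ring.
Qed.

Lemma wsum_ext f h1 h2 l : (forall k, h1 k = h2 k) -> wsum f h1 l -> wsum f h2 l.
Proof. by move=> /funext ->. Qed.

Lemma le_wsum f h1 h2 l1 l2 : (forall k, 0 <= f k) -> wsum f h1 l1 ->
  wsum f h2 l2 -> (forall k, h1 k <= h2 k) -> l1 <= l2.
Proof.
move=> f0 H1 H2 le12; rewrite -(cvg_lim _ H1)// -(cvg_lim _ H2)//.
apply: ler_lim; [by apply/cvg_ex; exists l1|by apply/cvg_ex; exists l2|].
by apply: nearW => n; apply: ler_sum => k _; rewrite ler_wpM2l.
Qed.

Lemma wsum_dominated f h1 h2 l2 : (forall k, 0 <= f k) ->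
  (forall k, 0 <= h1 k <= h2 k) -> wsum f h2 l2 -> exists l1, wsum f h1 l1.
Proof.
move=> f0 h12 H2; suff /cvg_ex[l Hl] : cvgn (series (fun k => f k * h1 k)) by exists l.
apply: (@series_le_cvg _ _ (fun k => f k * h2 k)).
- by move=> k; rewrite mulr_ge0//; case/andP: (h12 k).
- by move=> k; case/andP: (h12 k) => a b; rewrite mulr_ge0// (le_trans a b).
- by move=> k; rewrite ler_wpM2l//; case/andP: (h12 k).
- by apply/cvg_ex; exists l2.
Qed.

Lemma wsum_nneseries f h : (forall k, 0 <= f k * h k) ->
  (\sum_(0 <= k <oo) (f k * h k)%:E < +oo)%E ->
  exists2 l, wsum f h l & (\sum_(0 <= k <oo) (f k * h k)%:E)%E = l%:E.
Proof.
move=> fh0 fin.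
have S0 : (0 <= \sum_(0 <= k <oo) (f k * h k)%:E)%E.
  by apply: nneseries_ge0 => k _ _; rewrite lee_fin.
have cv : cvgn (series (fun k => f k * h k)).
  apply: nondecreasing_is_cvgn.
    by apply/nondecreasing_seqP => n; rewrite /series/= big_nat_recr//= lerDl.
  exists (fine (\sum_(0 <= k <oo) (f k * h k)%:E)%E) => _ [n _ <-].
  rewrite -lee_fin fineK ?ge0_fin_numE// -sumEFin.
  by apply: nneseries_lim_ge => k _ _; rewrite lee_fin.
exists (limn (series (fun k => f k * h k))); first exact: cv.
rewrite -EFin_lim//; congr (limn _); apply/funext => n /=.
by rewrite sumEFin.
Qed.

Lemma nneseries_wsum f h l : (forall k, 0 <= f k * h k) -> wsum f h l ->
  (\sum_(0 <= k <oo) (f k * h k)%:E)%E = l%:E.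
Proof.
move=> fh0 H; rewrite -(cvg_lim _ H)// -EFin_lim; last by apply/cvg_ex; exists l.
by congr (limn _); apply/funext => n /=; rewrite sumEFin.
Qed.

End WeightedSums.

Arguments wsum_lin {R f h1 h2 l1 l2} a b _ _.

(** * Generating functions *)

Section OffspringLaws.
Variable R : realType.
Implicit Types (f h : nat -> R) (s : R).

(* The moment condition E[X^2; X >= 2] <= c E[X; X >= 2], rounded up to an
   integer [M >= c] so that the tangent at [M] of k |-> g^k is controlled by
   Bernoulli's inequality; the weighted sum is E[X(X - M); X >= 2]. *)
Definition regular_law (M : nat) f : Prop :=
  [/\ defective_distribution f, (0 < mean f < +oo)%E &
   exists2 t, t <= 0 &
     wsum f (fun k => (1 < k)%:R * (k%:R * (k%:R - M%:R))) t].

Lemma wsum_mass f : defective_distribution f -> wsum f (fun=> 1) (genf f 1).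
Proof.
move=> [f0 f1].
have [||l Hl _] := @wsum_nneseries _ f (fun=> 1).
- by move=> k; rewrite mulr1.
- apply: (le_lt_trans _ (ltry 1)); apply: le_trans f1.
  by apply: lee_nneseries => k _ //; rewrite ?mulr1// lee_fin.
suff -> : genf f 1 = l by [].
rewrite /genf -(cvg_lim _ Hl)//; congr (limn _).
apply/funext => n; rewrite /pseries /series/=.
by apply: eq_bigr => k _; rewrite expr1n.
Qed.

Lemma wsum_genf f s : defective_distribution f -> 0 <= s <= 1 ->
  wsum f (fun k => s ^+ k) (genf f s).
Proof.
move=> df /andP[s0 s1].
have [l Hl] : exists l, wsum f (fun k => s ^+ k) l.
  apply: (wsum_dominated _ _ (wsum_mass df)) => [|k]; first by case: df.
  by rewrite exprn_ge0//= exprn_ile1.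
suff -> : genf f s = l by [].
by rewrite /genf -(cvg_lim _ Hl).
Qed.

Lemma wsum_dgenf f s : defective_distribution f -> (mean f < +oo)%E ->
  0 <= s <= 1 -> wsum f (fun k => k%:R * s ^+ k.-1) (dgenf f s).
Proof.
move=> df fm /andP[s0 s1].
have f0 k : 0 <= f k by case: df.
have [l Hl] : exists l, wsum f (fun k => k%:R * s ^+ k.-1) l.
  have [||m Hm _] := @wsum_nneseries _ f (fun k => k%:R).
  - by move=> k; rewrite mulr_ge0.
  - by under eq_eseriesr do rewrite mulrC.
  apply: (wsum_dominated _ _ Hm) => // k.
  by rewrite mulr_ge0// ?exprn_ge0//= ler_piMr// exprn_ile1.
suff -> : dgenf f s = l by [].
rewrite /dgenf /genf; apply: cvg_lim => //.
(* The series of [dgenf] starts at the term k = 1; the vanishing term k = 0 accounts for the shift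
   [n.+1]. *)
rewrite (_ : pseries _ _ = (fun n => series (fun k => f k * (k%:R * s ^+ k.-1)) n.+1)).
  by rewrite cvg_shiftS.
apply/funext => n; rewrite /pseries /series/= big_nat_recl//= mul0r mulr0 add0r.
by apply: eq_bigr => k _; rewrite /pseries_diffs; ring.
Qed.

Lemma genf_ge0 f s : defective_distribution f -> 0 <= s <= 1 -> 0 <= genf f s.
Proof.
move=> df s01; have f0 k : 0 <= f k by case: df.
have H := wsum_genf df s01.
(* The zero function is presented as a trivial linear combination, for which a [wsum] is at hand. *)
have := le_wsum f0 (wsum_lin 0 0 H H) H; rewrite !mul0r addr0; apply => k.
by rewrite !mul0r addr0 exprn_ge0//; case/andP: s01.
Qed.

Lemma genf_le1 f : defective_distribution f -> genf f 1 <= 1.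
Proof.
move=> df; have [f0 f1] := df; have H := wsum_mass df.
rewrite -lee_fin -(nneseries_wsum _ H) => [|k]; last by rewrite mulr1.
by under eq_eseriesr do rewrite mulr1.
Qed.

Lemma le_genf f : defective_distribution f ->
  {in `[0, 1] &, {homo genf f : x y / x <= y}}.
Proof.
move=> df x y x01 y01 xy; rewrite !in_itv/= in x01 y01.
apply: (le_wsum _ (wsum_genf df x01) (wsum_genf df y01)); first by case: df.
move=> k; apply: lerXn2r => //; rewrite ?nnegrE.
  by case/andP: x01. by case/andP: y01.
Qed.

Lemma genf_itv f s : defective_distribution f -> s \in `[0, 1] ->
  genf f s \in `[0, 1].
Proof.
move=> df; rewrite !in_itv/= => s01; rewrite genf_ge0//=.
apply: le_trans (genf_le1 df); have /andP[s0 s1] := s01.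
by apply: le_genf => //; rewrite in_itv/= ?s0 ?s1 ?ler01 ?lexx.
Qed.

Lemma le_dgenf f : defective_distribution f -> (mean f < +oo)%E ->
  {in `[0, 1] &, {homo dgenf f : x y / x <= y}}.
Proof.
move=> df fm x y x01 y01 xy; rewrite !in_itv/= in x01 y01.
apply: (le_wsum _ (wsum_dgenf df fm x01) (wsum_dgenf df fm y01)); first by case: df.
move=> k; rewrite ler_wpM2l//; apply: lerXn2r => //; rewrite ?nnegrE.
  by case/andP: x01. by case/andP: y01.
Qed.

Lemma mean_gt0_support f : (forall k, 0 <= f k) -> (0 < mean f)%E ->
  exists2 k, (0 < k)%N & 0 < f k.
Proof.
move=> f0 fm; apply: contrapT => H; move: fm.
rewrite /mean eseries0 ?ltxx// => -[|k] _ _; first by rewrite mul0r.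
have [fk|] := ltP 0 (f k.+1); first by exfalso; apply: H; exists k.+1.
by move=> fk; rewrite (_ : f k.+1 = 0) ?mulr0//; apply/le_anti; rewrite fk f0.
Qed.

Lemma wsum_gt0 f h l k : (forall k, 0 <= f k) -> (forall k, 0 <= h k) ->
  0 < f k -> 0 < h k -> wsum f h l -> 0 < l.
Proof.
move=> f0 h0 fk hk H; apply: (@lt_le_trans _ _ (f k * h k)); first exact: mulr_gt0.
rewrite -(cvg_lim _ H)//.
have nd : nondecreasing_seq (series (fun k => f k * h k)).
  apply/nondecreasing_seqP => n; rewrite /series/= big_nat_recr//= lerDl.
  exact: mulr_ge0.
apply: (@le_trans _ _ (series (fun k => f k * h k) k.+1)).
  rewrite /series/= big_nat_recr//= lerDr sumr_ge0// => i _; exact: mulr_ge0.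
by apply: nondecreasing_cvgn_le => //; apply/cvg_ex; exists l.
Qed.

Lemma dgenf_gt0 f s : defective_distribution f -> (0 < mean f < +oo)%E ->
  0 < s <= 1 -> 0 < dgenf f s.
Proof.
move=> df /andP[m0 m1] /andP[s0 s1]; have f0 k : 0 <= f k by case: df.
have [k k0 fk] := mean_gt0_support f0 m0.
have s01 : 0 <= s <= 1 by rewrite (ltW s0).
apply: (wsum_gt0 f0 _ fk _ (wsum_dgenf df m1 s01)) => [j|].
  by rewrite mulr_ge0// exprn_ge0// ltW.
by rewrite mulr_gt0// ?ltr0n// exprn_gt0.
Qed.

(** A positive mean forces some k >= 1 with f[k] > 0, and this single term already separates the two
    values. *)
Lemma genf_lt f x y : defective_distribution f -> (0 < mean f)%E ->
  0 <= x -> x < y -> y <= 1 -> genf f x < genf f y.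
Proof.
move=> df m0 x0 xy y1; have f0 k : 0 <= f k by case: df.
have [k k0 fk] := mean_gt0_support f0 m0.
have y0 : 0 < y by exact: le_lt_trans xy.
have Hx : wsum f _ _ := @wsum_genf f x df _.
have Hy : wsum f _ _ := @wsum_genf f y df _.
have H := wsum_lin 1 (-1) (Hy _) (Hx _).
rewrite -subr_gt0; have -> : genf f y - genf f x = 1 * genf f y + (-1) * genf f x by ring.
apply: (wsum_gt0 f0 _ fk _ (H _ _)).
- by move=> j; rewrite mul1r mulN1r subr_ge0 lerXn2r// ?nnegrE// ltW.
- by rewrite mul1r mulN1r subr_gt0 ltrXn2r// ?nnegrE ?(ltW y0)// -lt0n.
- by rewrite (ltW y0).
- by rewrite x0/= (le_trans (ltW xy)).
Qed.

Lemma genf_gt0 f s : defective_distribution f -> (0 < mean f)%E ->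
  0 < s <= 1 -> 0 < genf f s.
Proof.
move=> df m0 /andP[s0 s1]; apply: le_lt_trans (genf_lt df m0 (lexx 0) s0 s1).
by apply: genf_ge0 => //; rewrite lexx ler01.
Qed.

End OffspringLaws.

(** * Inequalities between powers, and the shape bounds obtained by summing them *)

Section ShapeBounds.
Variable R : realType.
Implicit Types (f : nat -> R) (g h u y : R).

(** Bernoulli's inequality for 1/y, free of division. With y = 1 - u it bounds 1 - (1 - u)^k from
    below by k u / (1 + k u). *)
Lemma expr_harmonic_le1 y k : 0 <= y <= 1 -> y ^+ k * (1 + k%:R * (1 - y)) <= 1.
Proof.
move=> /andP[y0 y1]; elim: k => [|k IH]; first by rewrite mul0r addr0 mulr1.
apply: le_trans IH; rewrite exprS -mulrA mulrCA ler_wpM2l ?exprn_ge0//.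
rewrite -subr_ge0 -natr1.
have -> : 1 + k%:R * (1 - y) - y * (1 + (k%:R + 1) * (1 - y)) =
  (k%:R + 1) * (1 - y) ^+ 2 :> R by ring.
by rewrite mulr_ge0 ?sqr_ge0// addr_ge0.
Qed.

Lemma expr_bernoulli y k : 0 <= y <= 1 -> 1 - k%:R * (1 - y) <= y ^+ k.
Proof.
move=> /andP[y0 y1]; elim: k => [|k IH]; first by rewrite mul0r subr0.
apply: (@le_trans _ _ (y * (1 - k%:R * (1 - y)))); last by rewrite exprS ler_wpM2l.
rewrite -subr_ge0 -natr1.
have -> : y * (1 - k%:R * (1 - y)) - (1 - (k%:R + 1) * (1 - y)) =
  k%:R * (1 - y) ^+ 2 :> R by ring.
by rewrite mulr_ge0 ?sqr_ge0.
Qed.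

(** Exact for the exponents 1 and 2. The quadratic term grows linearly in the exponent, which is
    what makes E[X; X >= 2] appear in [dgenf_increment_ge]. *)
Lemma expr_bernoulli2 u k : 0 <= u <= 1 ->
  1 - k.+1%:R * u + u ^+ 2 * k%:R <= (1 - u) ^+ k.+1.
Proof.
move=> /andP[u0 u1]; elim: k => [|k IH].
  by rewrite expr1 mul1r mulr0 addr0.
apply: (@le_trans _ _ ((1 - u) * (1 - k.+1%:R * u + u ^+ 2 * k%:R))).
  rewrite -subr_ge0 -!natr1.
  set z := (X in 0 <= X).
  have -> : z = u ^+ 2 * (k%:R * (1 - u)) by rewrite /z; ring.
  by rewrite mulr_ge0 ?sqr_ge0// mulr_ge0// subr_ge0.
by rewrite [leRHS]exprS ler_wpM2l// subr_ge0.
Qed.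

(* Tangent line at [M] of the convex function k |-> g^k, up to its slope. *)
Lemma expr_tangent M g k : 0 <= g <= 1 ->
  g ^+ M * (1 - (k%:R - M%:R) * (1 - g)) <= g ^+ k.
Proof.
move=> g01; have g0 : 0 <= g by case/andP: g01.
have [Mk|/ltnW kM] := leqP M k.
  rewrite -natrB// -[in leRHS](subnKC Mk) exprD ler_wpM2l ?exprn_ge0//.
  exact: expr_bernoulli.
have -> : 1 - (k%:R - M%:R) * (1 - g) = 1 + (M - k)%:R * (1 - g) :> R.
  by rewrite natrB//; ring.
rewrite -[in leLHS](subnKC kM) addKn exprD -mulrA -[leRHS]mulr1 ler_wpM2l ?exprn_ge0//.
exact: expr_harmonic_le1.
Qed.

(** For k >= 2 the factors k - M and g^k - g^M have opposite signs. The term k = 1, absent on the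
    right, is nonpositive on the left because M >= 1. *)
Lemma expr_centered M g k : (0 < M)%N -> 0 <= g <= 1 ->
  k%:R * (k%:R - M%:R) * g ^+ k <=
  g ^+ M * ((1 < k)%:R * (k%:R * (k%:R - M%:R))).
Proof.
move=> M0 /andP[g0 g1]; case: k => [|[|k]].
- by rewrite !mul0r !mulr0.
- rewrite mul0r mulr0 mulr_le0_ge0 ?exprn_ge0// mul1r subr_le0 ler1n.
  exact: M0.
rewrite mul1r -mulrA mulrC -subr_ge0.
have [Mk|/ltnW kM] := leqP M k.+2.
  rewrite -[in g ^+ k.+2](subnKC Mk) exprD.
  set a := g ^+ M; set b := g ^+ (_ - _).
  set x : R := k.+2%:R; set m : R := M%:R.
  have -> : a * (x * (x - m)) - (x - m) * (a * b) * x =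
    a * (x * (x - m)) * (1 - b) by ring.
  rewrite mulr_ge0 ?subr_ge0 ?exprn_ile1//.
  by rewrite mulr_ge0 ?exprn_ge0// mulr_ge0// subr_ge0 ler_nat.
rewrite -[in g ^+ M](subnKC kM) exprD.
set a := g ^+ k.+2; set b := g ^+ (_ - _).
set x : R := k.+2%:R; set m : R := M%:R.
have -> : a * b * (x * (x - m)) - (x - m) * a * x =
  a * x * ((m - x) * (1 - b)) by ring.
rewrite mulr_ge0//; first by rewrite mulr_ge0// exprn_ge0.
by rewrite mulr_ge0// subr_ge0 ?ler_nat ?exprn_ile1.
Qed.

Lemma mulrn_exprS g k : k%:R * g ^+ k = g * (k%:R * g ^+ k.-1).
Proof. by case: k => [|k]; rewrite ?mul0r ?mulr0//= exprS; ring. Qed.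

(** Multiply the tangent bound for g^k by k and sum: the deviation from g^M f'(1) is -g^M (1 - g) t,
    which is nonnegative. *)
Lemma dgenf_ge_dgenf1 M f g : (0 < M)%N -> regular_law M f -> 0 < g <= 1 ->
  g ^+ M * dgenf f 1 <= dgenf f g.
Proof.
move=> M0 [df /andP[m0 m1] [t t0 Ht]] /andP[g0 g1].
have f0 k : 0 <= f k by case: df.
have g01 : 0 <= g <= 1 by rewrite (ltW g0).
have o01 : 0 <= (1 : R) <= 1 by rewrite ler01 lexx.
have H1 := wsum_dgenf df m1 o01.
have Hg := wsum_dgenf df m1 g01.
(* The summation bounds even g f'(g); the null second term only matches the shape of [wsum_lin]. *)
suff : g ^+ M * dgenf f 1 <= g * dgenf f g + 0 * dgenf f g.
  rewrite mul0r addr0 => /le_trans; apply.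
  by rewrite ler_piMl// ltW// dgenf_gt0// ?m0 ?g0.
apply: (@le_trans _ _ (g ^+ M * dgenf f 1 + (- (g ^+ M * (1 - g))) * t)).
  rewrite lerDl mulNr -mulrN mulr_ge0 ?oppr_ge0// mulr_ge0 ?subr_ge0//.
  by rewrite exprn_ge0// ltW.
apply: (le_wsum f0 (wsum_lin _ _ H1 Ht) (wsum_lin _ _ Hg Hg)) => k.
rewrite mul0r addr0 -mulrn_exprS expr1n mulr1.
case: k => [|[|k]]; rewrite ?mul0r ?mulr0 ?addr0//.
  by rewrite mul1r mulr1 expr1 -[leRHS]expr1; apply: ler_wiXn2l; rewrite // ltW.
rewrite mul1r.
set x : R := k.+2%:R.
have -> : g ^+ M * x + - (g ^+ M * (1 - g)) * (x * (x - M%:R)) =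
  x * (g ^+ M * (1 - (x - M%:R) * (1 - g))) by ring.
by rewrite ler_wpM2l//; exact: expr_tangent.
Qed.

(** With u = (g - h) / g, the increment f(g) - f(h) is the sum of f[k] g^k (1 - (1 - u)^k). The
    harmonic bound gives k u / (1 + k u), and a tangent to 1/z makes this quadratic in k, so that
    the moment condition applies through [expr_centered]. *)
Lemma dgenf_increment_le M f g h : (0 < M)%N -> regular_law M f ->
  0 < g <= 1 -> 0 <= h <= g ->
  dgenf f g * (g - h) <= (1 + M%:R / g * (g - h)) * (genf f g - genf f h).
Proof.
move=> M0 [df /andP[m0 m1] [t t0 Ht]] /andP[g0 g1] /andP[h0 hg].
have f0 k : 0 <= f k by case: df.
have g01 : 0 <= g <= 1 by rewrite (ltW g0).
have h01 : 0 <= h <= 1 by rewrite h0 (le_trans hg).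
have Hd := wsum_dgenf df m1 g01.
pose u := (g - h) / g; have u0 : 0 <= u by rewrite divr_ge0 ?subr_ge0// ltW.
have dE : g - h = u * g by rewrite /u mulfVK// gt_eqF.
have hE : h = g * (1 - u) by rewrite mulrBr mulr1 [g * u]mulrC -dE; ring.
have u1 : u <= 1 by rewrite ler_pdivrMr// mul1r; lra.
have Mu : 0 < 1 + M%:R * u by rewrite ltr_pwDl// mulr_ge0.
(* The value of 1 / (1 + k u) at k = M, the point where the tangent is taken. *)
pose w := (1 + M%:R * u)^-1; have w0 : 0 < w by rewrite invr_gt0.
have wE : w * (1 + M%:R * u) = 1 by rewrite mulVf// gt_eqF.
have -> : M%:R / g * (g - h) = M%:R * u by rewrite /u; field; rewrite gt_eqF.
clearbody u.
rewrite mulrC -ler_pdivrMl// -/w; clearbody w.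
have -> : genf f g - genf f h = 1 * genf f g + (-1) * genf f h by ring.
(* The coefficient of [t] is the one left by the tangent once [expr_centered] has replaced g^k by
   g^M. *)
apply: (@le_trans _ _ (w * (g - h) * dgenf f g + (- (u ^+ 2 * w ^+ 2 * g ^+ M)) * t)).
  rewrite -mulrA lerDl mulNr -mulrN mulr_ge0 ?oppr_ge0//.
  by rewrite mulr_ge0 ?exprn_ge0 ?(ltW g0)// mulr_ge0 ?sqr_ge0.
apply: (le_wsum f0 (wsum_lin _ _ Hd Ht)
  (wsum_lin _ _ (wsum_genf df g01) (wsum_genf df h01))) => k.
rewrite mul1r mulN1r dE hE exprMn.
(* For z = 1 + k u the line w (2 - z w) is the tangent to 1/z at 1/w; the difference is the square
   (1 - z w)^2 over z. *)
have step1 : k%:R * u * (w * (2 - (1 + k%:R * u) * w)) <= 1 - (1 - u) ^+ k.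
  have zk : 0 < 1 + k%:R * u by rewrite ltr_pwDl// mulr_ge0.
  apply: (@le_trans _ _ (k%:R * u * (1 + k%:R * u)^-1)).
    apply: ler_wpM2l; first exact: mulr_ge0.
    rewrite -[leRHS]div1r ler_pdivlMr//.
    rewrite -subr_ge0; set z := 1 + _.
    have -> : 1 - w * (2 - z * w) * z = (1 - z * w) ^+ 2 by ring.
    exact: sqr_ge0.
  rewrite ler_pdivrMr//.
  have y01 : 0 <= 1 - u <= 1 by rewrite subr_ge0 u1 gerBl.
  have := expr_harmonic_le1 k y01.
  have -> : 1 - (1 - u) = u by ring.
  lra.
have := ler_wpM2l (exprn_ge0 k (ltW g0)) step1.
have -> : 2 - (1 + k%:R * u) * w = 1 - (k%:R - M%:R) * u * w.
  have -> : (2 : R) = 1 + w * (1 + M%:R * u) by rewrite wE.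
  ring.
have P := expr_centered k M0 g01.
have := ler_wpM2l (_ : 0 <= u ^+ 2 * w ^+ 2) P; rewrite mulr_ge0 ?sqr_ge0// => /(_ isT).
have K : w * u * (k%:R * g ^+ k) = w * u * (g * (k%:R * g ^+ k.-1)).
  by rewrite mulrn_exprS.
move: (k%:R * g ^+ k.-1) K => p.
set q := g ^+ M; set e := (1 < k)%:R; set G := g ^+ k; set Y := (1 - u) ^+ k.
move=> K A B; lra.
Qed.

(** For k >= 2, k <= M + k (k - M) / M amounts to (k - M)^2 >= 0; then sum against a total mass of
    at most 1. *)
Lemma regular_law_dgenf1 M f : (0 < M)%N -> regular_law M f -> dgenf f 1 <= M%:R.
Proof.
move=> M0 [df /andP[m0 m1] [t t0 Ht]].
have f0 k : 0 <= f k by case: df.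
have M0' : 0 < M%:R :> R by rewrite ltr0n.
have o01 : 0 <= (1 : R) <= 1 by rewrite ler01 lexx.
have H1 := wsum_dgenf df m1 o01.
apply: (@le_trans _ _ (M%:R * genf f 1 + M%:R^-1 * t)); last first.
  rewrite (@le_trans _ _ (M%:R * 1 + 0))// ?lerD ?mulr1 ?addr0//.
    by rewrite -[leRHS]mulr1 ler_wpM2l// genf_le1.
  by rewrite mulr_ge0_le0 ?invr_ge0.
apply: (le_wsum f0 H1 (wsum_lin _ _ (wsum_mass df) Ht)) => k.
rewrite expr1n !mulr1; case: k => [|[|k]].
- by rewrite mul0r mulr0 addr0.
- by rewrite mul0r mulr0 addr0 ler1n.
rewrite mul1r; set x : R := k.+2%:R.
rewrite -subr_ge0.
have -> : M%:R + M%:R^-1 * (x * (x - M%:R)) - x = M%:R^-1 * (x - M%:R) ^+ 2.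
  by field; rewrite gt_eqF.
by rewrite mulr_ge0 ?sqr_ge0// invr_ge0.
Qed.

(** The partial sums are monotone and bounded by [v] termwise, from k (k - 1) s^(k - 2) <= k^2; this
    gives convergence and the bound at once. *)
Lemma d2genf_le_wsum f s v : (forall k, 0 <= f k) -> 0 <= s <= 1 ->
  wsum f (fun k => (1 < k)%:R * k%:R ^+ 2) v -> d2genf f s <= v.
Proof.
move=> f0 /andP[s0 s1] Hv.
pose V k := f k * ((1 < k)%:R * k%:R ^+ 2).
have V0 k : 0 <= V k by rewrite /V !mulr_ge0 ?sqr_ge0.
have leV n : series V n <= v.
  rewrite -(cvg_lim _ Hv)//; apply: nondecreasing_cvgn_le.
    by apply/nondecreasing_seqP => m; rewrite /series/= big_nat_recr//= lerDl.
  by apply/cvg_ex; exists v.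
pose S := pseries (pseries_diffs (pseries_diffs f)) s.
have leS n : S n <= v.
  apply: le_trans (leV n.+2); rewrite /S /pseries /series/= !big_nat_recl//=.
  rewrite {1 2}/V mul0r mulr0 add0r mul0r mulr0 add0r.
  apply: ler_sum => k _; rewrite /V /pseries_diffs mul1r.
  rewrite (_ : _ * s ^+ k = f k.+2 * (k.+1%:R * k.+2%:R * s ^+ k)); last by ring.
  rewrite ler_wpM2l// -[leRHS]mulr1; apply: ler_pM.
  - by rewrite mulr_ge0.
  - by rewrite exprn_ge0.
  - by rewrite expr2 ler_wpM2r// ler_nat.
  - by rewrite exprn_ile1.
rewrite /d2genf /dgenf /genf; apply: limr_le; last exact: nearW.
apply: nondecreasing_is_cvgn; last by exists v => _ [n _ <-].
apply/nondecreasing_seqP => n; rewrite /S /pseries /series/= big_nat_recr//= lerDl.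
by rewrite mulr_ge0 ?exprn_ge0// !mulr_ge0.
Qed.

(** With u = (g - h) / g, each k >= 2 contributes f[k] g^k (k u - 1 + (1 - u)^k), at least f[k] (g -
    h)^2 k g^k / 2, to f'(g) (g - h) - (f(g) - f(h)). The tangent to g^k at M turns the sum into a
    multiple of W = E[X; X >= 2], and f''(rho) <= E[X^2; X >= 2] = t + M W <= M W. *)
Lemma dgenf_increment_ge M f rho g h : (0 < M)%N -> regular_law M f ->
  0 < rho <= 1 -> 0 < g <= 1 -> 0 <= h <= g ->
  (1 + g ^+ M * d2genf f rho / (2 * M%:R ^+ 2) * (g - h)) * (genf f g - genf f h)
  <= dgenf f g * (g - h).
Proof.
move=> M0 reg /andP[r0 r1] /andP[g0 g1] /andP[h0 hg].
have [df /andP[m0 m1] [t t0 Ht]] := reg.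
have f0 k : 0 <= f k by case: df.
have M0' : 0 < M%:R :> R by rewrite ltr0n.
have g01 : 0 <= g <= 1 by rewrite (ltW g0).
have h01 : 0 <= h <= 1 by rewrite h0 (le_trans hg).
have Hd := wsum_dgenf df m1 g01.
have o01 : 0 <= (1 : R) <= 1 by rewrite ler01 lexx.
have H1 := wsum_dgenf df m1 o01.
have [W HW] : exists W, wsum f (fun k => (1 < k)%:R * k%:R) W.
  apply: (wsum_dominated f0 _ H1) => k; rewrite expr1n mulr1 mulr_ge0//=.
  by rewrite ler_piMl// lern1 leq_b1.
have etaW : d2genf f rho <= M%:R * W.
  apply: (@le_trans _ _ (1 * t + M%:R * W)); last by rewrite mul1r gerDr.
  apply: (d2genf_le_wsum f0); first by rewrite (ltW r0).
  apply: wsum_ext (wsum_lin 1 M%:R Ht HW) => k; ring.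
have W0 : 0 <= W.
  have := le_wsum f0 (wsum_lin 0 0 HW HW) HW; rewrite !mul0r addr0; apply => k.
  by rewrite !mul0r addr0 mulr_ge0.
have gap : (g - h) ^+ 2 / 2 * g ^+ M * W <=
    (g - h) * dgenf f g + (-1) * (1 * genf f g + (-1) * genf f h).
  apply: (@le_trans _ _ ((g - h) ^+ 2 / 2 * g ^+ M * W +
     (- ((g - h) ^+ 2 / 2 * g ^+ M * (1 - g))) * t)).
    rewrite lerDl mulNr -mulrN mulr_ge0 ?oppr_ge0// mulr_ge0 ?subr_ge0//.
    by rewrite mulr_ge0 ?exprn_ge0 ?(ltW g0)// divr_ge0 ?sqr_ge0.
  apply: (le_wsum f0 (wsum_lin _ _ HW Ht) (wsum_lin _ _ Hd (wsum_lin _ _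
    (wsum_genf df g01) (wsum_genf df h01)))) => k.
  case: k => [|[|k]].
  - by rewrite !mul0r !mulr0 !expr0 addr0 mul1r mulN1r mulN1r; lra.
  - by rewrite !mul0r !mulr0 /= !expr1 expr0; lra.
  pose u := (g - h) / g; have u0 : 0 <= u by rewrite divr_ge0 ?subr_ge0// ltW.
  have dE : g - h = u * g by rewrite /u mulfVK// gt_eqF.
  have hE : h = g * (1 - u) by rewrite mulrBr mulr1 [g * u]mulrC -dE; ring.
  have u1 : u <= 1 by rewrite ler_pdivrMr// mul1r; lra.
  have u01 : 0 <= u <= 1 by rewrite u0.
  clearbody u.
  rewrite !mul1r /= [in leRHS]dE [in leRHS]hE exprMn.
  have B := expr_bernoulli2 k.+1 u01.
  have T := expr_tangent M k.+2 g01.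
  set Y := (1 - u) ^+ k.+2 in B *; set q := g ^+ M in T *.
  have E : u * g * (k.+2%:R * g ^+ k.+1) + -1 * (g ^+ k.+2 + -1 * (g ^+ k.+2 * Y)) =
     g ^+ k.+2 * (k.+2%:R * u - 1 + Y) by rewrite [g ^+ k.+2]exprS; ring.
  rewrite E.
  have -> : (g - h) ^+ 2 / 2 * q * k.+2%:R + - ((g - h) ^+ 2 / 2 * q * (1 - g)) *
     (k.+2%:R * (k.+2%:R - M%:R)) =
     (g - h) ^+ 2 * (k.+2%:R / 2) * (q * (1 - (k.+2%:R - M%:R) * (1 - g))) by ring.
  apply: (@le_trans _ _ ((g - h) ^+ 2 * (k.+2%:R / 2) * g ^+ k.+2)).
    by rewrite ler_wpM2l// mulr_ge0 ?sqr_ge0// divr_ge0.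
  rewrite mulrC; apply: ler_wpM2l; first by rewrite exprn_ge0// ltW.
  (* Uses g - h <= u, as g <= 1, and j / 2 <= j - 1 for the exponent j = [k.+2]. *)
  apply: (@le_trans _ _ (u ^+ 2 * k.+1%:R)); last by lra.
  apply: ler_pM; rewrite ?sqr_ge0 ?divr_ge0//.
    by rewrite dE exprMn ler_piMr ?sqr_ge0// exprn_ile1// ltW.
  have -> : k.+2%:R / 2 = k.+1%:R - k%:R / 2 :> R.
    by rewrite -[k.+2%:R]natr1 -[k.+1%:R]natr1; field.
  by rewrite gerBl divr_ge0.
set D := genf f g - genf f h.
have D0 : 0 <= D.
  by rewrite subr_ge0; apply: le_genf; rewrite // in_itv.
have d0 : 0 <= g - h by rewrite subr_ge0.
have dM : dgenf f g <= M%:R.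
  apply: le_trans (regular_law_dgenf1 M0 reg).
  by apply: le_dgenf => //; rewrite in_itv/= ?ler01 ?lexx.
have {}gap : (g - h) ^+ 2 / 2 * g ^+ M * W <= (g - h) * dgenf f g - D.
  by apply: le_trans gap _; rewrite /D; lra.
have DM : D <= M%:R * (g - h).
  have : 0 <= (g - h) ^+ 2 / 2 * g ^+ M * W.
    by rewrite !mulr_ge0 ?invr_ge0 ?exprn_ge0 ?(ltW g0).
  have := ler_wpM2l d0 dM; lra.
suff : g ^+ M * d2genf f rho / (2 * M%:R ^+ 2) * (g - h) * D <=
    (g - h) ^+ 2 / 2 * g ^+ M * W by lra.
have gM : 0 <= g ^+ M by rewrite exprn_ge0// ltW.
(* One factor M comes from f''(rho) <= M W and one from f(g) - f(h) <= M (g - h); hence the constant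
   2 M^2. *)
apply: (@le_trans _ _ (g ^+ M * (M%:R * W) / (2 * M%:R ^+ 2) * (g - h) * (M%:R * (g - h)))).
  have c0 : 0 <= (2 * M%:R ^+ 2)^-1 :> R by rewrite invr_ge0 mulr_ge0 ?sqr_ge0.
  apply: (@le_trans _ _ (g ^+ M * (M%:R * W) / (2 * M%:R ^+ 2) * (g - h) * D)).
    by rewrite ler_wpM2r// ler_wpM2r// ler_wpM2r// ler_wpM2l.
  rewrite ler_wpM2l// !mulr_ge0//.
rewrite le_eqVlt; apply/orP; left; apply/eqP.
by field; rewrite gt_eqF.
Qed.

(** By convexity f lies below its chord over [sigma, 1], whose end values are at most sigma and 1 -
    delta. *)
Lemma genf_contraction f (sigma delta s : R) : defective_distribution f ->
  0 <= sigma -> genf f sigma <= sigma -> 0 <= delta -> genf f 1 <= 1 - delta ->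
  sigma <= s -> s <= 1 -> sigma < 1 -> genf f s - sigma <= (1 - delta) * (s - sigma).
Proof.
move=> df s0 fs d0 f1 ss s1 sg1.
have f0 k : 0 <= f k by case: df.
pose l := (s - sigma) / (1 - sigma).
have l0 : 0 <= l by rewrite divr_ge0 ?subr_ge0// ltW.
have l1 : l <= 1 by rewrite ler_pdivrMr ?subr_gt0// mul1r; lra.
have lE : s - sigma = l * (1 - sigma) by rewrite /l mulfVK// gt_eqF// subr_gt0.
have s01 : 0 <= s <= 1 by rewrite s1 (le_trans s0).
have sg01 : 0 <= sigma <= 1 by rewrite s0 ltW.
have : genf f s <= (1 - l) * genf f sigma + l * genf f 1.
  apply: (le_wsum f0 (wsum_genf df s01)
    (wsum_lin _ _ (wsum_genf df sg01) (wsum_mass df))).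
  elim=> [|k IH]; first by rewrite !expr0; lra.
  apply: (@le_trans _ _ (s * ((1 - l) * sigma ^+ k + l * 1))).
    by rewrite exprS ler_wpM2l// (le_trans s0).
  have sE : s = sigma + l * (1 - sigma) by rewrite -lE; ring.
  rewrite -subr_ge0 exprS {1}sE; set x := sigma ^+ k.
  have -> : (1 - l) * (sigma * x) + l * 1 -
    (sigma + l * (1 - sigma)) * ((1 - l) * x + l * 1) =
    (1 - l) * l * ((1 - sigma) * (1 - x)) by ring.
  have x1 : x <= 1 by rewrite /x exprn_ile1// ltW.
  by apply: mulr_ge0; apply: mulr_ge0; rewrite // subr_ge0// ltW.
have l1' : 0 <= 1 - l by rewrite subr_ge0.
have A := ler_wpM2l l1' fs.
have B := ler_wpM2l l0 f1.
(* The slack between 1 - delta - sigma and (1 - delta) (1 - sigma). *)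
have C : 0 <= l * (delta * sigma) := mulr_ge0 l0 (mulr_ge0 d0 s0).
rewrite lE; lra.
Qed.

End ShapeBounds.

(** * Environments *)

Section Environments.
Variables (R : realType) (f : nat -> nat -> R).
Implicit Types (s x y : R).

(* F_(i, i + m) of the header. *)
Fixpoint comp_genf (i m : nat) (s : R) : R :=
  if m is m'.+1 then genf (f i.+1) (comp_genf i.+1 m' s) else s.

(** The definition peels off the outermost map; induction over generations adds a new innermost
    one. *)
Lemma comp_genfSr i m s :
  comp_genf i m.+1 s = comp_genf i m (genf (f (i + m).+1) s).
Proof.
elim: m i => [|m IH] i; first by rewrite addn0.
rewrite -[LHS]/(genf (f i.+1) (comp_genf i.+1 m.+1 s)) IH.
by rewrite addSnnS.
Qed.

(** Since [count_boundary] bounds the number of bad indices independently of n, the factor in front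
    stays bounded. *)
Lemma le_prod_except (K : R) (a b : nat -> R) (bad : pred nat) (r : seq nat) :
  1 <= K -> (forall i, i \in r -> 0 <= a i) -> (forall i, i \in r -> 0 <= b i) ->
  (forall i, i \in r -> ~~ bad i -> a i <= b i) ->
  (forall i, i \in r -> bad i -> a i <= K * b i) ->
  \prod_(i <- r) a i <= K ^+ count bad r * \prod_(i <- r) b i.
Proof.
move=> K1; have K0 : 0 <= K by exact: le_trans K1.
elim: r => [|j r IH] a0 b0 good_ab bad_ab; first by rewrite !big_nil mulr1.
have jr : j \in j :: r by rewrite mem_head.
have ir i : i \in r -> i \in j :: r by move=> ?; rewrite in_cons orbC; apply/orP; left.
rewrite !big_cons /= exprD mulrACA; apply: ler_pM; first exact: a0.
- by rewrite big_seq; apply: prodr_ge0 => i /ir; exact: a0.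
- have [bj|bj] := boolP (bad j); first by rewrite expr1; apply: bad_ab.
  by rewrite expr0 mul1r; apply: good_ab.
- apply: IH => i /ir; [exact: a0|exact: b0|exact: good_ab|exact: bad_ab].
Qed.

(* The indices at which the composed generating functions may leave the
   region controlled by [rho] and [sigma]: the first [n0] and the last [m0]. *)
Lemma count_boundary n0 m0 n m : (m <= n)%N ->
  (count [pred i | (i < n0)%N || (n - m0 < i)%N] (index_iota 1 m.+1) <= n0 + m0)%N.
Proof.
move=> mn; rewrite -size_filter.
rewrite -[leqRHS](_ : size (iota 0 n0 ++ iota (n - m0).+1 m0) = _); last first.
  by rewrite size_cat !size_iota.
apply: uniq_leq_size => [|i]; first by rewrite filter_uniq// iota_uniq.
rewrite mem_filter mem_index_iota mem_cat !mem_iota /=; lia.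
Qed.

(** * Unrolling the recursion for 1 / d_i *)

Section Telescoping.
Variables (n : nat) (d A : nat -> R) (C : R).
Hypotheses (d0 : forall i, (i <= n)%N -> 0 < d i)
  (A0 : forall i, (0 < i <= n)%N -> 0 < A i).

Let Pi m := \prod_(1 <= i < m.+1) A i.

Let Pi_gt0 m : (m <= n)%N -> 0 < Pi m.
Proof.
move=> mn; rewrite /Pi big_seq; apply: prodr_gt0 => i.
by rewrite mem_index_iota ltnS => /andP[i0 im]; rewrite A0// i0 (leq_trans im).
Qed.

(** The step hypothesis has the shape of [dgenf_increment_le], with d_(i+1) = g - h and d_i = f(g) -
    f(h). Dividing by A_(i+1) d_i d_(i+1) gives an affine recursion for 1/d, whose constant term
    accumulates into the sum. *)
Lemma inv_le_telescope :
  (forall i, (i < n)%N -> A i.+1 * d i.+1 <= (1 + C * d i.+1) * d i) ->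
  forall m, (m <= n)%N ->
  (d 0%N)^-1 <= (Pi m)^-1 * (d m)^-1 + C * \sum_(1 <= i < m.+1) (Pi i)^-1.
Proof.
move=> step; elim=> [|m IH] mn.
  by rewrite /Pi !big_geq// invr1 mul1r mulr0 addr0.
apply: (le_trans (IH (ltnW mn))).
rewrite [in leRHS]big_nat_recr//= mulrDr [leRHS]addrCA [leLHS]addrC lerD2l.
have P0 := Pi_gt0 (ltnW mn).
have a0 : 0 < A m.+1 by exact: A0.
have dm := d0 (ltnW mn); have dm1 := d0 mn.
have -> : Pi m.+1 = Pi m * A m.+1 by rewrite /Pi big_nat_recr.
have -> : (Pi m * A m.+1)^-1 * (d m.+1)^-1 + C * (Pi m * A m.+1)^-1 =
   (Pi m)^-1 * ((1 + C * d m.+1) / (A m.+1 * d m.+1)).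
  by field; rewrite !gt_eqF.
rewrite ler_wpM2l ?invr_ge0 ?(ltW P0)// ler_pdivlMr ?mulr_gt0//.
by rewrite mulrC ler_pdivrMr// step.
Qed.

Lemma inv_ge_telescope :
  (forall i, (i < n)%N -> (1 + C * d i.+1) * d i <= A i.+1 * d i.+1) ->
  forall m, (m <= n)%N ->
  (Pi m)^-1 * (d m)^-1 + C * \sum_(1 <= i < m.+1) (Pi i)^-1 <= (d 0%N)^-1.
Proof.
move=> step; elim=> [|m IH] mn.
  by rewrite /Pi !big_geq// invr1 mul1r mulr0 addr0.
apply: (le_trans _ (IH (ltnW mn))).
rewrite [in leLHS]big_nat_recr//= mulrDr [leLHS]addrCA [leRHS]addrC lerD2l.
have P0 := Pi_gt0 (ltnW mn).
have a0 : 0 < A m.+1 by exact: A0.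
have dm := d0 (ltnW mn); have dm1 := d0 mn.
have -> : Pi m.+1 = Pi m * A m.+1 by rewrite /Pi big_nat_recr.
have -> : (Pi m * A m.+1)^-1 * (d m.+1)^-1 + C * (Pi m * A m.+1)^-1 =
   (Pi m)^-1 * ((1 + C * d m.+1) / (A m.+1 * d m.+1)).
  by field; rewrite !gt_eqF.
rewrite ler_wpM2l ?invr_ge0 ?(ltW P0)// ler_pdivrMr ?mulr_gt0//.
by rewrite ler_pdivlMl// mulrC step.
Qed.

End Telescoping.

(** * Location of the composed generating functions *)

Section RegularEnvironments.
Variable M : nat.
Hypotheses (M_gt0 : (0 < M)%N)
  (f_regular : forall n, (0 < n)%N -> regular_law M (f n)).

Let f_distr n : (0 < n)%N -> defective_distribution (f n).
Proof. by move=> /f_regular[]. Qed.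

Let f_mean n : (0 < n)%N -> (0 < mean (f n) < +oo)%E.
Proof. by move=> /f_regular[]. Qed.

Let in01 s : (s \in `[0, 1]) = (0 <= s <= 1).
Proof. by rewrite in_itv. Qed.

Lemma comp_genf_itv i m s : 0 <= s <= 1 -> 0 <= comp_genf i m s <= 1.
Proof.
move=> s01; elim: m i => [//|m IH] i /=.
by rewrite -in01; apply: genf_itv; [exact: f_distr|rewrite in01].
Qed.

Lemma comp_genf_lt i m x y : 0 <= x -> x < y -> y <= 1 ->
  comp_genf i m x < comp_genf i m y.
Proof.
move=> x0 xy y1; elim: m i => [//|m IH] i /=.
have /andP[m0 _] := f_mean (ltn0Sn i).
apply: genf_lt => //; first exact: f_distr.
  by have /andP[] : 0 <= comp_genf i.+1 m x <= 1
    by apply: comp_genf_itv; rewrite x0 (le_trans (ltW xy)).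
by have /andP[] : 0 <= comp_genf i.+1 m y <= 1
    by apply: comp_genf_itv; rewrite y1 (le_trans x0 (ltW xy)).
Qed.

Let one01 : 0 <= (1 : R) <= 1. Proof. by rewrite ler01 lexx. Qed.

(** Monotonicity propagates rho <= f(rho) from the innermost map outwards. The outermost map is
    f_(i+1), hence the condition on [i.+1]. *)
Lemma comp_genf1_ge rho n0 : 0 < rho < 1 ->
  (forall n, (n0 <= n)%N -> rho <= genf (f n) rho) ->
  forall i m, (n0 <= i.+1)%N -> rho <= comp_genf i m 1.
Proof.
move=> /andP[r0 r1] fr i m; elim: m i => [|m IH] i ni /=; first exact: ltW.
apply: (le_trans (fr _ ni)); apply: le_genf; rewrite ?in01 ?comp_genf_itv//.
- exact: f_distr.
- by rewrite (ltW r0) (ltW r1).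
- by apply: IH; apply: leq_trans ni _.
Qed.

(** Only finitely many i precede n0. Going back one index at a time, a positive bound r is replaced
    by the minimum of r and f(r), again positive. *)
Lemma comp_genf1_inf rho n0 : 0 < rho < 1 ->
  (forall n, (n0 <= n)%N -> rho <= genf (f n) rho) ->
  exists2 r, 0 < r <= 1 & forall i m, r <= comp_genf i m 1.
Proof.
move=> rho01 fr; have /andP[r0 r1] := rho01.
suff [r r01 H] : exists2 r, 0 < r <= 1 &
    forall i m, (n0 - n0 <= i.+1)%N -> r <= comp_genf i m 1.
  by exists r => // i m; apply: H; rewrite subnn.
elim: {2}n0 => [|k [r /andP[s0 s1] IH]].
  exists rho; first by rewrite r0 ltW.
  by move=> i m; rewrite subn0; exact: comp_genf1_ge.
(* The only index that lowering the threshold from [n0 - k] to [n0 - k.+1] can add. *)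
pose i0 := (n0 - k.+1).-1.
have /andP[m0 _] := f_mean (ltn0Sn i0).
have s01 : 0 < r <= 1 by rewrite s0.
have g0 := genf_gt0 (f_distr (ltn0Sn i0)) m0 s01.
exists (Num.min r (genf (f i0.+1) r)).
  by rewrite lt_min s0 g0/= ge_min s1.
move=> i m ni; have [ki|ki] := leqP (n0 - k) i.+1.
  by rewrite ge_min IH.
have -> : i = i0 by rewrite /i0; move: ni ki; clear; lia.
case: m => [|m]; first by rewrite ge_min s1.
rewrite ge_min orbC /= le_genf ?in01 ?comp_genf_itv ?(ltW s0)//.
- exact: f_distr.
- by apply: IH; rewrite /i0; clear; lia.
Qed.

(** While an iterate exceeds sigma, its excess shrinks by the factor 1 - delta at each map; once
    below sigma it stays there. *)
Lemma comp_genf1_sup n0 sigma eps (delta : R) : 0 <= sigma < 1 ->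
  (forall n, (n0 <= n)%N -> genf (f n) sigma <= sigma) ->
  0 < delta -> (forall n, (0 < n)%N -> genf (f n) 1 <= 1 - delta) -> 0 < eps ->
  exists m0, forall i m, (n0 <= i.+1)%N -> (m0 <= m)%N ->
    comp_genf i m 1 <= sigma + eps.
Proof.
move=> /andP[sg0 sg1] fs d0 fd e0.
have d1 : delta <= 1.
  have := fd 1%N isT; have := genf_ge0 (f_distr (ltn0Sn 0)) one01; lra.
pose q := 1 - delta; have q0 : 0 <= q by rewrite subr_ge0.
have q1 : `|q| < 1 by rewrite ger0_norm// /q ltrBlDr ltrDl.
have H i m : (n0 <= i.+1)%N -> comp_genf i m 1 <= sigma + q ^+ m * (1 - sigma).
  elim: m i => [|m IH] i ni /=; first by rewrite expr0 mul1r; lra.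
  set x := comp_genf i.+1 m 1.
  have x01 : 0 <= x <= 1 by exact: comp_genf_itv.
  have qm : 0 <= q ^+ m.+1 * (1 - sigma).
    by rewrite mulr_ge0 ?exprn_ge0// subr_ge0 ltW.
  have df := f_distr (ltn0Sn i).
  have [xs|/ltW xs] := leP x sigma.
    apply: (@le_trans _ _ sigma); last by rewrite lerDl.
    apply: le_trans (fs _ ni); apply: le_genf; rewrite ?in01 ?sg0 ?(ltW sg1)//.
  have /andP[_ x1] := x01.
  have := genf_contraction df sg0 (fs _ ni) (ltW d0) (fd _ (ltn0Sn i)) xs x1 sg1.
  have xm : x <= sigma + q ^+ m * (1 - sigma) by apply: IH; apply: leq_trans ni _.
  have : q * (x - sigma) <= q * (q ^+ m * (1 - sigma)).
    by rewrite ler_wpM2l// lerBlDl.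
  rewrite -/q exprS; lra.
have /cvgrPdist_lt /(_ eps e0) [m0 _ Hm0] := cvg_expr q1.
exists m0 => i m ni mm; apply: (le_trans (H i m ni)); rewrite lerD2l.
have := Hm0 m mm; rewrite /= sub0r normrN ger0_norm ?exprn_ge0// => qe.
apply: le_trans (ltW qe); rewrite ler_piMr ?exprn_ge0//; lra.
Qed.

Let A n i := dgenf (f i) (comp_genf i (n - i) 1).
Let d n i := comp_genf i (n - i) 1 - comp_genf i (n - i) 0.
Let Pi n m := \prod_(1 <= i < m.+1) A n i.

Let comp_genf1_gt0 i m : 0 < comp_genf i m 1.
Proof.
have : 0 <= comp_genf i m 0 <= 1 by apply: comp_genf_itv; rewrite lexx ler01.
by case/andP => c0 _; apply: le_lt_trans c0 _; apply: comp_genf_lt.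
Qed.

Let A_gt0 n i : (0 < i)%N -> 0 < A n i.
Proof.
move=> i0; apply: dgenf_gt0; [exact: f_distr|exact: f_mean|].
by rewrite comp_genf1_gt0; have /andP[_ ->] := comp_genf_itv i (n - i) one01.
Qed.

Let Pi_gt0 n m : 0 < Pi n m.
Proof.
rewrite /Pi big_seq; apply: prodr_gt0 => i; rewrite mem_index_iota => /andP[i0 _].
exact: A_gt0.
Qed.

Let d_gt0 n i : 0 < d n i.
Proof. by rewrite subr_gt0; apply: comp_genf_lt. Qed.

Lemma mu_gt0 n s : 0 < s <= 1 -> 0 < mu f n s.
Proof.
move=> s01; rewrite /mu big_seq; apply: prodr_gt0 => i.
rewrite mem_index_iota => /andP[i0 _].
by apply: dgenf_gt0; [exact: f_distr|exact: f_mean|].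
Qed.

Let comp_genf0_itv n i : 0 <= comp_genf i (n - i) 0 <= comp_genf i (n - i) 1.
Proof.
have c01 : 0 <= comp_genf i (n - i) 0 <= 1.
  by apply: comp_genf_itv; rewrite lexx ler01.
by rewrite (ltW (comp_genf_lt _ _ _ _ _)) ?ltr01// andbT; case/andP: c01.
Qed.

Let dS n i : (i < n)%N -> d n i = genf (f i.+1) (comp_genf i.+1 (n - i.+1) 1) -
  genf (f i.+1) (comp_genf i.+1 (n - i.+1) 0).
Proof. by move=> ni; rewrite /d -(subnSK ni). Qed.

(** * Comparison with the environment at rho *)

Section LowerBounds.
Variables (rho : R) (n0 : nat).
Hypotheses (rho01 : 0 < rho < 1)
  (f_rho : forall n, (n0 <= n)%N -> rho <= genf (f n) rho).

Let mu_le_Pi : exists2 K, 0 < K & forall n m, (m <= n)%N -> mu f m rho <= K * Pi n m.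
Proof.
have [r /andP[r0 r1] Hr] := comp_genf1_inf rho01 f_rho.
have /andP[h0 h1] := rho01.
have rho01' : 0 <= rho <= 1 by rewrite !ltW.
have rM0 : 0 < r ^+ M by rewrite exprn_gt0.
have K1 : 1 <= (r ^+ M)^-1 by rewrite invf_ge1// exprn_ile1// ltW.
(* There is no exceptional block at the end: F_(i,n)(1) >= rho holds for i >= n0 right up to i =
   n. *)
exists ((r ^+ M)^-1 ^+ (n0 + 0)); first by rewrite exprn_gt0// invr_gt0.
move=> n m mn.
apply: (@le_trans _ _ ((r ^+ M)^-1 ^+
   count [pred i | (i < n0)%N || (n - 0 < i)%N] (index_iota 1 m.+1) * Pi n m)); last first.
  rewrite ler_wpM2r ?(ltW (Pi_gt0 _ _))//.
  by apply: ler_weXn2l => //; exact: count_boundary.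
apply: le_prod_except => // i; rewrite mem_index_iota ltnS => /andP[i0 im].
- by rewrite ltW// dgenf_gt0//; [exact: f_distr|exact: f_mean|rewrite h0 ltW].
- by rewrite ltW// A_gt0.
- rewrite /= subn0 negb_or -leqNgt => /andP[n0i _].
  have /andP[_ m1] := f_mean i0.
  apply: le_dgenf; rewrite ?in01 ?comp_genf_itv//; first exact: f_distr.
  by apply: (comp_genf1_ge rho01 f_rho); apply: leq_trans n0i _.
(* With g = F_(i,n)(1) >= r: r^M f_i'(rho) <= g^M f_i'(1) <= f_i'(g). *)
- move=> _; have /andP[_ m1] := f_mean i0.
  have df := f_distr i0.
  have c01 : 0 < comp_genf i (n - i) 1 <= 1.
    by rewrite comp_genf1_gt0; have /andP[_ ->] := comp_genf_itv i (n - i) one01.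
  rewrite mulrC ler_pdivlMr// mulrC.
  apply: le_trans (dgenf_ge_dgenf1 M_gt0 (f_regular i0) c01).
  apply: ler_pM; rewrite ?(ltW rM0)//.
  + by rewrite ltW// dgenf_gt0// ?f_mean// h0 ltW.
  + by apply: lerXn2r; rewrite ?nnegrE ?(ltW r0) ?(ltW (comp_genf1_gt0 _ _)).
  + by apply: le_dgenf; rewrite // ?in01// ltW.
Qed.

Lemma mean_bound_below : exists2 c, 0 < c & forall n,
  c <= (\prod_(1 <= i < n.+1) dgenf (f i) (comp_genf i (n - i) 1)) * (mu f n rho)^-1.
Proof.
have [K K0 HK] := mu_le_Pi; exists K^-1; first by rewrite invr_gt0.
move=> n; have mu0 : 0 < mu f n rho by apply: mu_gt0; case/andP: rho01 => -> /ltW.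
by rewrite ler_pdivlMr// ler_pdivrMl//; exact: HK.
Qed.

Lemma survival_bound_below : exists2 c, 0 < c & forall n, (0 < n)%N ->
  c <= nu f n rho * (comp_genf 0 n 1 - comp_genf 0 n 0).
Proof.
have [K K0 HK] := mu_le_Pi.
have [r /andP[r0 r1] Hr] := comp_genf1_inf rho01 f_rho.
have h01 : 0 < rho <= 1 by case/andP: rho01 => -> /ltW.
(* Dominates the constants M / g of [dgenf_increment_le], as every g here is at least r. *)
pose C := M%:R / r; have C0 : 0 <= C by rewrite divr_ge0// ltW.
have C1 : 0 < 1 + C by rewrite ltr_pwDl.
exists ((1 + C) * K)^-1; first by rewrite invr_gt0 mulr_gt0.
move=> n n1.
have dn : d n n = 1 by rewrite /d subnn /= subr0.
have := @inv_le_telescope n (d n) (A n) C (fun i _ => d_gt0 n i) _ _ n (leqnn n).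
have d0E : d n 0 = comp_genf 0 n 1 - comp_genf 0 n 0 by rewrite /d subn0.
rewrite dn d0E invr1 mulr1 => H.
have {}H : (comp_genf 0 n 1 - comp_genf 0 n 0)^-1 <=
    (Pi n n)^-1 + C * \sum_(1 <= i < n.+1) (Pi n i)^-1.
  apply: H => [i /andP[i0 _]|i ni]; first exact: A_gt0.
  have c01 : 0 < comp_genf i.+1 (n - i.+1) 1 <= 1.
    by rewrite comp_genf1_gt0; have /andP[_ ->] := comp_genf_itv i.+1 (n - i.+1) one01.
  rewrite (dS ni) /A /d.
  apply: (le_trans (dgenf_increment_le M_gt0 (f_regular (ltn0Sn i)) c01 (comp_genf0_itv _ _))).
  rewrite ler_wpM2r -?dS// ?(ltW (d_gt0 _ _))//.
  rewrite lerD2l ler_wpM2r ?(ltW (d_gt0 n i.+1))//.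
  by rewrite /C ler_wpM2l// lef_pV2 ?posrE// comp_genf1_gt0.
have D0 : 0 < comp_genf 0 n 1 - comp_genf 0 n 0 by rewrite subr_gt0 comp_genf_lt.
have {}H : (comp_genf 0 n 1 - comp_genf 0 n 0)^-1 <= (1 + C) * K * nu f n rho.
  apply: (le_trans H).
  (* As d_n = 1, the boundary term is 1 / (A_1 ... A_n), itself the last summand; this is where n >=
     1 enters. *)
  apply: (@le_trans _ _ ((1 + C) * \sum_(1 <= i < n.+1) (Pi n i)^-1)).
    rewrite [leRHS]mulrDl mul1r lerD2r big_nat_recr//= lerDr sumr_ge0// => i _.
    by rewrite invr_ge0 ltW// Pi_gt0.
  rewrite -mulrA ler_wpM2l ?(ltW C1)// /nu mulr_sumr.
  rewrite [leLHS]big_seq [leRHS]big_seq; apply: ler_sum => i.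
  rewrite mem_index_iota ltnS => /andP[_ ni].
  have mu0 : 0 < mu f i rho by exact: mu_gt0.
  by rewrite ler_pdivlMr// mulrC ler_pdivrMr ?Pi_gt0// HK.
rewrite -ler_pdivrMr// mulrC ler_pdivrMr ?mulr_gt0//.
by rewrite mulrC.
Qed.

End LowerBounds.

(** * Comparison with the environment at sigma + eps *)

Section UpperBounds.
Variables (rho sigma eps dl eta : R) (n0 : nat).
Hypotheses (rho01 : 0 < rho < 1)
  (f_rho : forall n, (n0 <= n)%N -> rho <= genf (f n) rho)
  (dl_gt0 : 0 < dl) (f_dl : forall n, (0 < n)%N -> genf (f n) 1 <= 1 - dl)
  (eta_gt0 : 0 < eta) (f_eta : forall n, (0 < n)%N -> eta <= d2genf (f n) rho)
  (sigma01 : rho < sigma < 1)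
  (f_sigma : forall n, (n0 <= n)%N -> genf (f n) sigma <= sigma)
  (eps_gt0 : 0 < eps) (sigma_eps : sigma + eps <= 1).

Let se01 : 0 < sigma + eps <= 1.
Proof.
rewrite sigma_eps andbT addr_gt0//.
by case/andP: rho01 => + _; case/andP: sigma01 => + _ => /[swap]; exact: lt_trans.
Qed.

Let Pi_le_mu : exists2 K, 0 < K &
  forall n m, (m <= n)%N -> Pi n m <= K * mu f m (sigma + eps).
Proof.
have /andP[h0 h1] := rho01; have /andP[s0 s1] := sigma01.
have [||m0 Hm0] := @comp_genf1_sup n0 sigma eps dl _ f_sigma dl_gt0 f_dl.
- by rewrite s1 andbT ltW// (lt_trans h0).
- exact: eps_gt0.
have /andP[t0 t1] := se01; set t := sigma + eps in t0 t1 Hm0 *.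
have tM0 : 0 < t ^+ M by rewrite exprn_gt0.
have K1 : 1 <= (t ^+ M)^-1 by rewrite invf_ge1// exprn_ile1// ltW.
exists ((t ^+ M)^-1 ^+ (n0 + m0)); first by rewrite exprn_gt0// invr_gt0.
move=> n m mn.
apply: (@le_trans _ _ ((t ^+ M)^-1 ^+
   count [pred i | (i < n0)%N || (n - m0 < i)%N] (index_iota 1 m.+1) * mu f m t)); last first.
  rewrite ler_wpM2r ?(ltW (mu_gt0 _ _))//.
  by apply: ler_weXn2l => //; exact: count_boundary.
apply: le_prod_except => // i; rewrite mem_index_iota ltnS => /andP[i0 im].
- by rewrite ltW// A_gt0.
- by rewrite ltW// dgenf_gt0//; [exact: f_distr|exact: f_mean].
- rewrite /= negb_or -!leqNgt => /andP[n0i mi].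
  have /andP[_ m1] := f_mean i0.
  apply: le_dgenf; rewrite ?in01 ?comp_genf_itv ?(ltW t0)//; first exact: f_distr.
  apply: Hm0; first exact: leqW.
  (* If n < m0 the truncated difference [n - m0] is 0, and i >= 1 rules this case out. *)
  by move: i0 mi; clear; lia.
(* At an exceptional index, t^M A_i <= t^M f_i'(1) <= f_i'(t). *)
- move=> _; have /andP[_ m1] := f_mean i0.
  rewrite mulrC ler_pdivlMr// mulrC.
  apply: le_trans (dgenf_ge_dgenf1 M_gt0 (f_regular i0) se01).
  rewrite ler_wpM2l ?(ltW tM0)//.
  have c01 := comp_genf_itv i (n - i) one01.
  apply: le_dgenf; rewrite // ?in01//; first exact: f_distr.
  by case/andP: c01.
Qed.

Lemma mean_bound_above : exists C, forall n,
  (\prod_(1 <= i < n.+1) dgenf (f i) (comp_genf i (n - i) 1)) * (mu f n (sigma + eps))^-1 <= C.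
Proof.
have [K K0 HK] := Pi_le_mu; exists K => n.
by rewrite ler_pdivrMr ?mu_gt0//; exact: HK.
Qed.

Lemma survival_bound_above : exists C, forall n,
  nu f n (sigma + eps) * (comp_genf 0 n 1 - comp_genf 0 n 0) <= C.
Proof.
have [K K0 HK] := Pi_le_mu.
have [r /andP[r0 r1] Hr] := comp_genf1_inf rho01 f_rho.
have h01 : 0 < rho <= 1 by case/andP: rho01 => -> /ltW.
have M2 : 0 < 2 * M%:R ^+ 2 :> R by rewrite mulr_gt0// exprn_gt0// ltr0n.
(* A lower bound, uniform in i and n, for the constants of [dgenf_increment_ge], from g >= r and
   f''(rho) >= eta. *)
pose B := r ^+ M * eta / (2 * M%:R ^+ 2).
have B0 : 0 < B by rewrite divr_gt0// mulr_gt0// exprn_gt0.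
exists (K / B) => n.
have D0 : 0 < comp_genf 0 n 1 - comp_genf 0 n 0 by rewrite subr_gt0 comp_genf_lt.
have dn : d n n = 1 by rewrite /d subnn /= subr0.
have := @inv_ge_telescope n (d n) (A n) B (fun i _ => d_gt0 n i) _ _ n (leqnn n).
have d0E : d n 0 = comp_genf 0 n 1 - comp_genf 0 n 0 by rewrite /d subn0.
rewrite dn d0E invr1 mulr1 => H.
have {}H : (Pi n n)^-1 + B * \sum_(1 <= i < n.+1) (Pi n i)^-1 <=
    (comp_genf 0 n 1 - comp_genf 0 n 0)^-1.
  apply: H => [i /andP[i0 _]|i ni]; first exact: A_gt0.
  have c01 : 0 < comp_genf i.+1 (n - i.+1) 1 <= 1.
    by rewrite comp_genf1_gt0; have /andP[_ ->] := comp_genf_itv i.+1 (n - i.+1) one01.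
  have := dgenf_increment_ge M_gt0 (f_regular (ltn0Sn i)) h01 c01 (comp_genf0_itv _ _).
  rewrite -dS//; apply: le_trans.
  rewrite ler_wpM2r ?(ltW (d_gt0 _ _))// lerD2l ler_wpM2r ?(ltW (d_gt0 n i.+1))//.
  rewrite /B ler_wpM2r ?invr_ge0 ?(ltW M2)//; apply: ler_pM.
  - by rewrite exprn_ge0// ltW.
  - exact: ltW.
  - by apply: lerXn2r; rewrite ?nnegrE ?(ltW r0) ?(ltW (comp_genf1_gt0 _ _)).
  - exact: f_eta.
have {}H : B / K * nu f n (sigma + eps) <= (comp_genf 0 n 1 - comp_genf 0 n 0)^-1.
  apply: le_trans H.
  apply: (@le_trans _ _ (B * \sum_(1 <= i < n.+1) (Pi n i)^-1)); last first.
    by rewrite lerDr invr_ge0 ltW// Pi_gt0.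
  rewrite -mulrA ler_wpM2l ?(ltW B0)// /nu mulr_sumr.
  rewrite [leLHS]big_seq [leRHS]big_seq; apply: ler_sum => i.
  rewrite mem_index_iota ltnS => /andP[_ ni].
  have mu0 : 0 < mu f i (sigma + eps) by exact: mu_gt0.
  rewrite -invfM lef_pV2 ?posrE ?Pi_gt0 ?mulr_gt0//.
  exact: HK.
have := ler_wpM2r (ltW D0) H; rewrite mulVf ?gt_eqF// => {}H.
rewrite ler_pdivlMr// -[K]mulr1 -ler_pdivrMl//.
by apply: le_trans H; rewrite le_eqVlt; apply/orP; left; apply/eqP; ring.
Qed.

End UpperBounds.
End RegularEnvironments.
End Environments.

(** * The law of the process *)

Lemma nneseries_single (R : realType) (u : nat -> \bar R) j : (forall k, 0 <= u k)%E ->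
  (forall k, k != j -> u k = 0%E) -> (\sum_(0 <= k <oo) u k = u j)%E.
Proof.
move=> u0 uE; rewrite (@nneseriesD1 _ _ j xpredT)// eseries0 ?adde0// => k _ /=; exact: uE.
Qed.

(** Padding the triangle x <= k with zeros gives a full double series, whose order can be exchanged
    by nonnegativity. *)
Lemma nneseries_cauchy (R : realType) (c : nat -> nat -> \bar R) :
  (forall x y, 0 <= c x y)%E ->
  (\sum_(0 <= k <oo) \sum_(0 <= x < k.+1) c x (k - x)%N =
   \sum_(0 <= x <oo) \sum_(0 <= y <oo) c x y)%E.
Proof.
move=> c0; pose a k x := if (x <= k)%N then c x (k - x)%N else 0%E.
have a0 k x : (0 <= a k x)%E by rewrite /a; case: ifP.
transitivity (\sum_(0 <= k <oo) \sum_(0 <= x <oo) a k x)%E.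
  apply: eq_eseriesr => k _.
  rewrite [RHS](nneseries_split 0 k.+1)// add0n [X in (_ + X)%E]eseries0 ?adde0.
    rewrite [LHS]big_nat [RHS]big_nat; apply: eq_bigr => x /andP[_ xk].
    by rewrite /a -ltnS xk.
  by move=> x kx _; rewrite /a leqNgt kx.
rewrite nneseries_interchange//; apply: eq_eseriesr => x _.
rewrite (nneseries_split 0 x)// add0n [X in (X + _)%E]big1_seq ?add0e.
  rewrite -nneseries_addn//; apply: eq_eseriesr => y _.
  by rewrite /a leq_addl addnK.
by move=> k /=; rewrite mem_index_iota /a => /andP[_ kx]; rewrite leqNgt kx.
Qed.

(** * Events independent of the variables not yet used *)

Section IndependentEvents.
Context {d : measure_display} {T : measurableType d} {R : realType}.
Variables (P : probability T R) (I : choiceType) (X : I -> T -> natD).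
Hypothesis mX : forall i, measurable_fun setT (X i).
Implicit Types (B : set T) (D : set I).

(** Plays the role of independence from a past sigma-algebra, for one event B at a time. *)
Definition independent_event B D : Prop :=
  measurable B /\ forall J : {fset I}, [set` J] `<=` D ->
  forall A : I -> set natD,
  P (B `&` \bigcap_(i in [set` J]) (X i @^-1` A i)) =
  (P B * \prod_(i <- J) P (X i @^-1` A i))%E.

Lemma measurable_preimage i (A : set natD) : measurable (X i @^-1` A).
Proof. by rewrite -[X in measurable X]setTI; exact: mX. Qed.

Lemma independent_eventT D : independent_family P D X -> independent_event setT D.
Proof.
move=> iX; split; first exact: measurableT.
by move=> J JD A; rewrite setTI iX// probability_setT mul1e.
Qed.

Lemma independent_event0 D : independent_event set0 D.
Proof.
by split => [|J _ A]; [exact: measurable0|rewrite set0I measure0 mul0e].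
Qed.

Lemma sub_independent_event B D D' : D' `<=` D ->
  independent_event B D -> independent_event B D'.
Proof. by move=> DD [mB H]; split=> // J JD; apply: H => i /JD /DD. Qed.

(** Conditions on X_i and on a finite family avoiding i are together conditions on a finite family
    in D. The product formula is the case of the empty family. *)
Lemma independent_eventI B D i (A : set natD) : D i -> independent_event B D ->
  independent_event (B `&` X i @^-1` A) (D `\ i) /\
  P (B `&` X i @^-1` A) = (P B * P (X i @^-1` A))%E.
Proof.
move=> Di [mB H].
have key (J : {fset I}) (A' : I -> set natD) : [set` J] `<=` D `\ i ->
    P (B `&` X i @^-1` A `&` \bigcap_(j in [set` J]) (X j @^-1` A' j)) =
    (P B * (P (X i @^-1` A) * \prod_(j <- J) P (X j @^-1` A' j)))%E.
  move=> JD; have iJ : i \notin J by apply/negP => /JD [_ /=]; apply.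
  pose A2 j := if j == i then A else A' j.
  have A2J j : j \in J -> A2 j = A' j.
    by move=> jJ; rewrite /A2; case: eqP => // ji; rewrite -ji jJ in iJ.
  have -> : (\prod_(j <- J) P (X j @^-1` A' j) = \prod_(j <- J) P (X j @^-1` A2 j))%E.
    rewrite [LHS]big_seq [RHS]big_seq; apply: eq_bigr => j jJ.
    by rewrite A2J.
  have -> : P (X i @^-1` A) = P (X i @^-1` A2 i) by rewrite /A2 eqxx.
  rewrite -(big_fsetU1 _ (fun j => P (X j @^-1` A2 j)) iJ) -H; last first.
    by move=> j /=; rewrite in_fset1U => /orP[/eqP->//|/JD[]].
  congr (P _); rewrite -setIA; congr (_ `&` _).
  apply/seteqP; split => [w [Aw Jw] j /=|w Jw].
    rewrite in_fset1U => /orP[/eqP->|jJ]; first by rewrite /A2 eqxx.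
    by rewrite A2J//; exact: Jw.
  split; first by have := Jw i; rewrite /= in_fset1U eqxx /A2 eqxx; exact.
  by move=> j jJ; have := Jw j; rewrite /= in_fset1U A2J// jJ orbT; exact.
have E : P (B `&` X i @^-1` A) = (P B * P (X i @^-1` A))%E.
  have := key fset0 (fun=> setT); rewrite big_seq_fset0 mule1 => <-.
    rewrite (_ : \bigcap_(j in _) _ = setT) ?setIT//.
    by apply/seteqP; split.
  by move=> j; rewrite /= in_fset0.
split=> //; split; first by apply: measurableI => //; exact: measurable_preimage.
by move=> J JD A'; rewrite key// E muleA.
Qed.

Lemma independent_event_bigcup D (F : nat -> set T) : trivIset setT F ->
  (forall n, independent_event (F n) D) ->
  independent_event (\bigcup_n F n) D.
Proof.
move=> tF iF; have mF n : measurable (F n) by case: (iF n).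
split; first exact: bigcup_measurable.
move=> J JD A; rewrite setI_bigcupl.
have mC : measurable (\bigcap_(i in [set` J]) (X i @^-1` A i)).
  by apply: fin_bigcap_measurable => // i _; exact: measurable_preimage.
rewrite !measure_semi_bigcup//; [|exact: bigcup_measurable| | |].
(* Finiteness of the product allows it to be taken out of the series. *)
- have -> : (\prod_(i <- J) P (X i @^-1` A i) =
      (fine (\prod_(i <- J) P (X i @^-1` A i)))%:E)%E.
    rewrite fineK//; apply: (big_ind (fun x => x \is a fin_num)) => //.
      by move=> x y; exact: fin_numM.
    by move=> i _; apply: fin_num_measure; exact: measurable_preimage.
  rewrite muleC -nneseriesZl//; apply: eq_eseriesr => n _.
  rewrite muleC fineK; first by case: (iF n) => _; apply.
  apply: (big_ind (fun x => x \is a fin_num)) => //.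
    by move=> x y; exact: fin_numM.
  by move=> i _; apply: fin_num_measure; exact: measurable_preimage.
- by move=> n; exact: measurableI.
- exact: trivIset_setIr.
- by apply: bigcup_measurable => n _; exact: measurableI.
Qed.

End IndependentEvents.

Lemma addDA : associative addD.
Proof. by move=> [x|] [y|] [z|] //=; rewrite /addD addnA. Qed.

Lemma add0D : left_id (Some 0%N) addD.
Proof. by case. Qed.

Lemma addD0 : right_id (Some 0%N) addD.
Proof. by case=> [x|] //=; rewrite /addD addn0. Qed.

HB.instance Definition _ := Monoid.isLaw.Build natD (Some 0%N) addD addDA add0D addD0.

Lemma addD_eqSome (x y : natD) s : addD x y = Some s <->
  exists2 k, (k <= s)%N & x = Some k /\ y = Some (s - k)%N.
Proof.
split=> [|[k ks [-> ->]]]; last by rewrite /addD subnKC.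
case: x y => [x|] [y|] //= [<-]; exists x; first exact: leq_addr.
by rewrite addKn.
Qed.

(** * Recursion for the law of the process and its generating function *)

Section ProcessLaw.
Context {d : measure_display} {T : measurableType d} {R : realType}.
Variables (P : probability T R) (f : nat -> nat -> R).
Variable X : nat -> nat -> {RV P >-> natD}.
Hypotheses (f_distr : forall n, (0 < n)%N -> defective_distribution (f n))
  (f_mean : forall n, (0 < n)%N -> (mean (f n) < +oo)%E)
  (X_offspring : offspring_variables f X).

Let Z := GW (fun n j => X n j).
Let S n m w : natD := \big[addD/Some 0%N]_(1 <= j < m.+1) X n j w.
Let XI (nj : nat * nat) : T -> natD := X nj.1 nj.2.

(* The variables not yet used when the first [m] summands of generation [n]
   have been added up. *)
Let later n m : set (nat * nat) := [set nj |
  ((0 < nj.1)%N /\ (0 < nj.2)%N) /\ ((n < nj.1)%N \/ (n = nj.1 /\ (m < nj.2)%N))].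

Let at_ n z := [set w | Z n w = Some z].
(** The number m of summands is decoupled from the population z, so that induction on m uses one
    fresh variable at a time; m = z recovers Z_(n+1). *)
Let at_sum n z m s := [set w | Z n w = Some z /\ S n.+1 m w = Some s].

Let mXI i : measurable_fun setT (XI i).
Proof. exact: measurable_funPT. Qed.

Let S0 n w : S n 0 w = Some 0%N.
Proof. by rewrite /S big_geq. Qed.

Let SS n m w : S n m.+1 w = addD (S n m w) (X n m.+1 w).
Proof. by rewrite /S big_nat_recr. Qed.

Let XE n j k : (0 < n)%N -> (0 < j)%N -> P (XI (n, j) @^-1` [set Some k]) = (f n k)%:E.
Proof. by move=> n0 j0; case: X_offspring => _ + _; exact. Qed.

Let at_sum_step n z m s x : set T := if (x <= s)%N
  then at_sum n z m x `&` XI (n.+1, m.+1) @^-1` [set Some (s - x)%N] else set0.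

Let at_sumS n z m s : at_sum n z m.+1 s = \bigcup_x at_sum_step n z m s x.
Proof.
apply/seteqP; split=> [w [Zw]|w [x _]].
  rewrite SS => /addD_eqSome[k ks [Sk Xk]]; exists k => //.
  by rewrite /at_sum_step ks.
rewrite /at_sum_step; case: ifP => // xs [[Zw Sx] Xx]; split=> //.
by rewrite SS; apply/addD_eqSome; exists x.
Qed.

Let trivIset_at_sum_step n z m s : trivIset setT (at_sum_step n z m s).
Proof.
move=> i j _ _ [w []]; rewrite /at_sum_step.
by case: ifP => // _ [[_ Si] _]; case: ifP => // _ [[_ Sj] _]; move: Si; rewrite Sj => -[].
Qed.

Let independent_at_sum n z : independent_event P XI (at_ n z) (later n.+1 0) ->
  forall m s, independent_event P XI (at_sum n z m s) (later n.+1 m).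
Proof.
move=> iz; elim=> [|m IH] s.
  have [->|s0] := eqVneq s 0%N.
    rewrite (_ : at_sum n z 0 0 = at_ n z)//.
    by apply/seteqP; split=> w; [case|move=> Zw; split=> //; rewrite S0].
  rewrite (_ : at_sum n z 0 s = set0); first exact: independent_event0.
  by apply/seteqP; split=> w // [_]; rewrite S0 => -[] /esym/eqP; rewrite (negbTE s0).
rewrite at_sumS; apply: independent_event_bigcup => // x.
rewrite /at_sum_step; case: ifP => _; last exact: independent_event0.
have [|H _] := independent_eventI (i := (n.+1, m.+1)) mXI [set Some (s - x)%N] _ (IH x).
  by split => //; right.
apply: sub_independent_event H => -[i j] /= [ij0 H]; split.
  by split=> //; case: H => [|[? /ltnW]]; [left|right].
by move=> [ei ej]; move: H; rewrite ei ej ltnn => -[//|[_]]; rewrite ltnn.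
Qed.

Let at_S n k : at_ n.+1 k = \bigcup_z at_sum n z z k.
Proof.
apply/seteqP; split=> [w|w [z _ [Zw Sw]]]; last by rewrite /at_/= /Z /= -/Z Zw.
by rewrite /at_ /= /Z /= -/Z; case E : (Z n w) => [z|//] Sw; exists z.
Qed.

Let trivIset_at_sum n k : trivIset setT (fun z => at_sum n z z k).
Proof. by move=> i j _ _ [w [[Zi _] [Zj _]]]; move: Zi; rewrite Zj => -[]. Qed.

(** [later n.+2 0] avoids generation n + 1 altogether, so independence holds uniformly in the number
    z of summands and passes to the union over z. *)
Let independent_at n z : independent_event P XI (at_ n z) (later n.+1 0).
Proof.
elim: n z => [|n IH] z.
  have [->|z1] := eqVneq z 1%N.
    rewrite (_ : at_ 0 1 = setT); last by apply/seteqP; split.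
    apply: independent_eventT => J JD A mA.
    have [iX _ _] := X_offspring; apply: iX => // nj /JD.
    by case.
  rewrite (_ : at_ 0 z = set0); first exact: independent_event0.
  by apply/seteqP; split=> w // -[] /esym/eqP; rewrite (negbTE z1).
rewrite at_S; apply: independent_event_bigcup => // k.
apply: sub_independent_event (independent_at_sum (IH k) k z) => -[i j] /= [ij0 H].
by split=> //; left; case: H => [/ltnW//|[<- _]].
Qed.

Lemma measurable_GW_eq n z : measurable [set w | Z n w = Some z].
Proof. by have [] := independent_at n z. Qed.

Let m_at_sum n z m s : measurable (at_sum n z m s).
Proof. by have [] := independent_at_sum (independent_at n z) m s. Qed.

Let p n z := P (at_ n z).
Let q n z m s := P (at_sum n z m s).

Let q0 n z s : q n z 0 s = if s == 0%N then p n z else 0%E.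
Proof.
rewrite /q; case: eqP => [->|s0].
  congr (P _); apply/seteqP; split=> w; first by case.
  by move=> Zw; split=> //; rewrite S0.
rewrite (_ : at_sum n z 0 s = set0) ?measure0//.
by apply/seteqP; split=> w // [_]; rewrite S0 => -[] /esym.
Qed.

Let qS n z m s :
  q n z m.+1 s = (\sum_(0 <= x < s.+1) q n z m x * (f n.+1 (s - x)%N)%:E)%E.
Proof.
rewrite /q at_sumS measure_semi_bigcup//; last first.
- by rewrite -at_sumS.
- move=> x; rewrite /at_sum_step; case: ifP => // _.
  by apply: measurableI => //; exact: measurable_preimage.
rewrite (nneseries_split 0 s.+1)// add0n [X in (_ + X)%E]eseries0 ?adde0; last first.
  by move=> x sx _; rewrite /at_sum_step leqNgt sx measure0.
rewrite [LHS]big_nat [RHS]big_nat; apply: eq_bigr => x /andP[_ xs].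
rewrite /at_sum_step -ltnS xs -(@XE n.+1 m.+1)//.
have [|_ E] := independent_eventI (i := (n.+1, m.+1)) mXI [set Some (s - x)%N] _
  (independent_at_sum (independent_at n z) m x); last exact: E.
by split => //; right.
Qed.

Let pS n k : p n.+1 k = (\sum_(0 <= z <oo) q n z z k)%E.
Proof. by rewrite /p at_S measure_semi_bigcup// -at_S; exact: measurable_GW_eq. Qed.

Let p_ge0 n z : (0 <= p n z)%E. Proof. exact: measure_ge0. Qed.
Let q_ge0 n z m s : (0 <= q n z m s)%E. Proof. exact: measure_ge0. Qed.

Let p_fin n z : p n z = (fine (p n z))%:E.
Proof. by rewrite fineK// fin_num_measure//; exact: measurable_GW_eq. Qed.

Let genf_series n s : (0 < n)%N -> 0 <= s <= 1 ->
  (\sum_(0 <= k <oo) (s ^+ k)%:E * (f n k)%:E = (genf (f n) s)%:E)%E.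
Proof.
move=> n0 s01; rewrite -(nneseries_wsum _ (wsum_genf (f_distr n0) s01)).
  by apply: eq_eseriesr => k _; rewrite [in RHS]EFinM muleC.
move=> k; rewrite mulr_ge0//; first by case: (f_distr n0).
by rewrite exprn_ge0//; case/andP: s01.
Qed.

Let dgenf_series n s : (0 < n)%N -> 0 <= s <= 1 ->
  (\sum_(0 <= k <oo) (k%:R * s ^+ k.-1)%:E * (f n k)%:E = (dgenf (f n) s)%:E)%E.
Proof.
move=> n0 s01; rewrite -(nneseries_wsum _ (wsum_dgenf (f_distr n0) (f_mean n0) s01)).
  by apply: eq_eseriesr => k _; rewrite [in RHS]EFinM muleC.
move=> k; rewrite mulr_ge0//; first by case: (f_distr n0).
by rewrite mulr_ge0// exprn_ge0//; case/andP: s01.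
Qed.

Let fE_ge0 n k : (0 < n)%N -> (0 <= (f n k)%:E)%E.
Proof. by move=> n0; rewrite lee_fin; case: (f_distr n0). Qed.

Let q_genf n z m s : 0 <= s <= 1 ->
  (\sum_(0 <= k <oo) (s ^+ k)%:E * q n z m k = p n z * (genf (f n.+1) s ^+ m)%:E)%E.
Proof.
move=> s01; have s0 : 0 <= s by case/andP: s01.
have sE k : (0 <= (s ^+ k)%:E)%E by rewrite lee_fin exprn_ge0.
elim: m => [|m IH].
  rewrite (nneseries_single (j := 0%N)) => [|k|k k0]; first by rewrite q0 expr0 muleC.
    exact: mule_ge0.
  by rewrite q0 (negbTE k0) mule0.
transitivity (\sum_(0 <= k <oo) \sum_(0 <= x < k.+1)
    ((s ^+ x)%:E * q n z m x) * ((s ^+ (k - x))%:E * (f n.+1 (k - x)%N)%:E))%E.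
  apply: eq_eseriesr => k _; rewrite qS ge0_sume_distrr; last first.
    by move=> x _; rewrite mule_ge0// fE_ge0.
  rewrite [LHS]big_nat [RHS]big_nat; apply: eq_bigr => x /andP[_ xk].
  by rewrite muleACA -EFinM -exprD subnKC.
rewrite (@nneseries_cauchy _ (fun x y =>
  ((s ^+ x)%:E * q n z m x) * ((s ^+ y)%:E * (f n.+1 y)%:E))%E); last first.
  by move=> x y; rewrite !mule_ge0// fE_ge0.
transitivity (\sum_(0 <= x <oo) (genf (f n.+1) s)%:E * ((s ^+ x)%:E * q n z m x))%E.
  apply: eq_eseriesr => x _; rewrite [RHS]muleC -genf_series//.
  have -> : ((s ^+ x)%:E * q n z m x = (fine ((s ^+ x)%:E * q n z m x))%:E)%E.
    by rewrite fineK// fin_numM// fin_num_measure.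
  by rewrite nneseriesZl// => y _; rewrite mule_ge0// fE_ge0.
rewrite nneseriesZl; last by move=> x _; rewrite mule_ge0.
by rewrite IH muleCA -EFinM -exprS.
Qed.

(** The derivative of [q_genf], obtained on the series themselves so that s = 1 is included. *)
Let q_dgenf n z m s : 0 <= s <= 1 ->
  (\sum_(0 <= k <oo) (k%:R * s ^+ k.-1)%:E * q n z m k =
   p n z * (m%:R * genf (f n.+1) s ^+ m.-1 * dgenf (f n.+1) s)%:E)%E.
Proof.
move=> s01; have s0 : 0 <= s by case/andP: s01.
have sE k : (0 <= (s ^+ k)%:E)%E by rewrite lee_fin exprn_ge0.
have dE k : (0 <= (k%:R * s ^+ k.-1)%:E)%E by rewrite lee_fin mulr_ge0// exprn_ge0.
elim: m => [|m IH].
  rewrite (nneseries_single (j := 0%N)) => [|k|k k0]; first by rewrite !mul0r mule0 mul0e.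
    exact: mule_ge0.
  by rewrite q0 (negbTE k0) mule0.
(* The product rule applied to s^x s^y inside the convolution. *)
pose c x y := (((x%:R * s ^+ x.-1)%:E * q n z m x) * ((s ^+ y)%:E * (f n.+1 y)%:E) +
   ((s ^+ x)%:E * q n z m x) * ((y%:R * s ^+ y.-1)%:E * (f n.+1 y)%:E))%E.
transitivity (\sum_(0 <= k <oo) \sum_(0 <= x < k.+1) c x (k - x)%N)%E.
  apply: eq_eseriesr => k _; rewrite qS ge0_sume_distrr; last first.
    by move=> x _; rewrite mule_ge0// fE_ge0.
  rewrite [LHS]big_nat [RHS]big_nat; apply: eq_bigr => x /andP[_ xk].
  rewrite /c muleACA [X in _ = (_ + X)%E]muleACA -ge0_muleDl ?mule_ge0 ?fE_ge0//.
  congr (_ * _)%E; rewrite -!EFinM -EFinD; congr EFin.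
  rewrite -[in LHS](@subnKC x k)//; move: (k - x)%N => y.
  case: x {xk} => [|x]; first by rewrite add0n !mul0r add0r expr0 mul1r.
  case: y => [|y]; first by rewrite addn0 mul0r mulr0 addr0 expr0 mulr1.
  have -> : s ^+ (x.+1 + y.+1).-1 = s * s ^+ x * s ^+ y.
    by rewrite addSn addnS /= exprS exprD mulrA.
  by rewrite natrD [s ^+ x.+1]exprS [s ^+ y.+1]exprS /=; ring.
rewrite nneseries_cauchy; last first.
  by move=> x y; rewrite adde_ge0// !mule_ge0// fE_ge0.
transitivity (\sum_(0 <= x <oo)
    ((genf (f n.+1) s)%:E * ((x%:R * s ^+ x.-1)%:E * q n z m x) +
     (dgenf (f n.+1) s)%:E * ((s ^+ x)%:E * q n z m x)))%E.
  apply: eq_eseriesr => x _; rewrite /c nneseriesD; last 2 first.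
    by move=> y _ _; rewrite !mule_ge0// fE_ge0.
    by move=> y _ _; rewrite !mule_ge0// fE_ge0.
  have qf (r : R) : (r%:E * q n z m x = (fine (r%:E * q n z m x))%:E)%E.
    by rewrite fineK// fin_numM// fin_num_measure.
  rewrite qf [in X in (_ + X = _)%E]qf !nneseriesZl; last 2 first.
    by move=> y _; rewrite mule_ge0// fE_ge0.
    by move=> y _; rewrite mule_ge0// fE_ge0.
  by rewrite genf_series// dgenf_series// -!qf muleC [X in (_ + X = _)%E]muleC.
have g0 : (0 <= (genf (f n.+1) s)%:E)%E by rewrite lee_fin genf_ge0//; exact: f_distr.
have d0 : (0 <= (dgenf (f n.+1) s)%:E)%E.
  rewrite -dgenf_series//; apply: nneseries_ge0 => k _ _.
  by rewrite mule_ge0// fE_ge0.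
rewrite nneseriesD; [|by move=> x _ _; rewrite !mule_ge0..].
rewrite !nneseriesZl; [|by move=> x _; rewrite !mule_ge0..].
rewrite IH q_genf// [p n z]p_fin -!EFinM -EFinD; congr EFin.
case: m {IH c} => [|m]; first by rewrite !mul0r !mulr0 !expr0 add0r mul1r mulr1 mul1r mulrC.
rewrite -[m.+2%:R]natr1 /= exprS; ring.
Qed.

(** Given Z_n = z, the next generation contributes f_(n+1)(s)^z; summing over z evaluates the
    generating function of Z_n at f_(n+1)(s). *)
Lemma GW_genf n s : 0 <= s <= 1 ->
  (\sum_(0 <= k <oo) (s ^+ k)%:E * P [set w | Z n w = Some k] =
   (comp_genf f 0 n s)%:E)%E.
Proof.
elim: n s => [|n IH] s s01; have s0 : 0 <= s by case/andP: s01.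
  rewrite (nneseries_single (j := 1%N)) => [|k|k k1].
  - by rewrite (_ : [set w | _] = setT) ?probability_setT ?mule1//; apply/seteqP; split.
  - by rewrite mule_ge0// lee_fin exprn_ge0.
  - rewrite (_ : [set w | _] = set0) ?measure0 ?mule0//.
    by apply/seteqP; split=> w //= -[] /esym/eqP; rewrite (negbTE k1).
rewrite comp_genfSr add0n.
have g01 : 0 <= genf (f n.+1) s <= 1.
  by have := @genf_itv _ (f n.+1) s (f_distr (ltn0Sn n)); rewrite !in_itv/=; apply.
rewrite -IH//.
transitivity (\sum_(0 <= k <oo) \sum_(0 <= z <oo) (s ^+ k)%:E * q n z z k)%E.
  apply: eq_eseriesr => k _; rewrite -/(at_ n.+1 k) -/(p n.+1 k) pS nneseriesZl//.
rewrite nneseries_interchange; last first.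
  by move=> k z; rewrite mule_ge0// lee_fin exprn_ge0.
by apply: eq_eseriesr => z _; rewrite q_genf// muleC.
Qed.

Lemma GW_dgenf n s : 0 <= s <= 1 ->
  (\sum_(0 <= k <oo) (k%:R * s ^+ k.-1)%:E * P [set w | Z n w = Some k] =
   (\prod_(1 <= i < n.+1) dgenf (f i) (comp_genf f i (n - i) s))%:E)%E.
Proof.
elim: n s => [|n IH] s s01; have s0 : 0 <= s by case/andP: s01.
  rewrite (nneseries_single (j := 1%N)) => [|k|k k1].
  - rewrite (_ : [set w | _] = setT) ?probability_setT; last by apply/seteqP; split.
    by rewrite expr0 mulr1 mule1 big_geq.
  - by rewrite mule_ge0// lee_fin mulr_ge0// exprn_ge0.
  - rewrite (_ : [set w | _] = set0) ?measure0 ?mule0//.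
    by apply/seteqP; split=> w //= -[] /esym/eqP; rewrite (negbTE k1).
have g01 : 0 <= genf (f n.+1) s <= 1.
  by have := @genf_itv _ (f n.+1) s (f_distr (ltn0Sn n)); rewrite !in_itv/=; apply.
transitivity (\sum_(0 <= k <oo) \sum_(0 <= z <oo) (k%:R * s ^+ k.-1)%:E * q n z z k)%E.
  by apply: eq_eseriesr => k _; rewrite -/(at_ n.+1 k) -/(p n.+1 k) pS nneseriesZl.
rewrite nneseries_interchange; last first.
  by move=> k z; rewrite mule_ge0// lee_fin mulr_ge0// exprn_ge0.
rewrite big_nat_recr//= subnn /= EFinM.
transitivity ((\sum_(0 <= k <oo) (k%:R * genf (f n.+1) s ^+ k.-1)%:E *
    P [set w | Z n w = Some k]) * (dgenf (f n.+1) s)%:E)%E; last first.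
  rewrite IH//; congr (_ * _)%E; congr EFin.
  rewrite [LHS]big_nat [RHS]big_nat; apply: eq_bigr => i /andP[i0 ni].
  by rewrite subSn// comp_genfSr subnKC.
rewrite muleC -nneseriesZl; last first.
  move=> k _; rewrite mule_ge0// lee_fin mulr_ge0// exprn_ge0//.
  by case/andP: g01.
apply: eq_eseriesr => z _; rewrite q_dgenf// [in LHS]EFinM muleA [LHS]muleC.
by congr (_ * _)%E; exact: muleC.
Qed.

End ProcessLaw.

Lemma expectD_series {d : measure_display} {T : measurableType d} {R : realType}
    (P : probability T R) (Y : T -> natD) (h : nat -> R) (A : set nat) :
  (forall k, measurable [set w | Y w = Some k]) -> (forall k, 0 <= h k) ->
  expectD P Y h A =
  (\sum_(0 <= k <oo) (h k)%:E * P [set w | Y w = Some k /\ A k])%E.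
Proof.
move=> mY h0; pose F k := [set w | Y w = Some k /\ A k].
have mF k : measurable (F k).
  have [Ak|nAk] := pselect (A k).
    by rewrite (_ : F k = [set w | Y w = Some k])//; apply/seteqP; split=> w // [].
  by rewrite (_ : F k = set0)//; apply/seteqP; split=> w // [].
rewrite /expectD (_ : Y @^-1` _ = \bigcup_k F k); last first.
  apply/seteqP; split=> [w [k Ak Yk]|w [k _ [Yk Ak]]]; first by exists k.
  by exists k.
rewrite ge0_integral_bigcup//; first last.
- by move=> i j _ _ [w [[Yi _] [Yj _]]]; move: Yi; rewrite Yj => -[].
- by move=> w _; rewrite lee_fin.
- apply/measurable_fun_bigcup => // k.
  apply: (eq_measurable_fun (cst (h k)%:E)); last exact: measurable_cst.
  by move=> w /set_mem[Yw _]; rewrite Yw.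
apply: eq_eseriesr => k _; rewrite -integral_cst; last exact: mF.
by apply: eq_integral => w /set_mem[Yw _]; rewrite Yw.
Qed.

Lemma ltn_hitting_time {T : Type} {R : realType} (Z : nat -> T -> natD) a w n :
  (n%:R%:E < @hitting_time T R Z a w)%E <->
  forall m, (0 < m)%N -> Z m w = a -> (n < m)%N.
Proof.
split=> [H m m0 Zm|H].
  rewrite -(ltr_nat R) -lte_fin; apply: (lt_le_trans H).
  by apply: ereal_inf_lbound; exists m.
apply: (@lt_le_trans _ _ (n.+1%:R%:E)); first by rewrite lte_fin ltr_nat.
by apply: le_ereal_inf_tmp => _ [m [m0 Zm] <-]; rewrite lee_fin ler_nat H.
Qed.

(** Both 0 and Delta are absorbing, so survival up to n is read off Z_n alone. Hitting times ignore
    the index 0, where Z_0 = 1 settles the claim. *)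
Lemma ltn_absorption_time {T : Type} {R : realType} (X : nat -> nat -> T -> natD) n w :
  (n%:R%:E < @absorption_time T R (GW X) w)%E <->
  exists k, GW X n w = Some k.+1.
Proof.
have absorb m n' a : a = Some 0%N \/ a = Delta -> (m <= n')%N -> GW X m w = a -> GW X n' w = a.
  move=> ha; elim: n' => [|n' IH]; first by rewrite leqn0 => /eqP->.
  rewrite leq_eqVlt => /orP[/eqP->//|]; rewrite ltnS => /IH{}IH /IH /= ->.
  by case: ha => -> //; rewrite big_geq.
rewrite /absorption_time lt_min; split.
  move=> /andP[/ltn_hitting_time H0 /ltn_hitting_time HD].
  case: n H0 HD => [|n] H0 HD; first by exists 0%N.
  case E : (GW X n.+1 w) => [[|k]|]; last 1 first.
  - by have := HD n.+1 isT E; rewrite ltnn.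
  - by have := H0 n.+1 isT E; rewrite ltnn.
  - by exists k.
move=> [k Zk]; apply/andP; split; apply/ltn_hitting_time => m m0 Zm.
  rewrite ltnNge; apply/negP => mn.
  by have := absorb m n _ (or_introl erefl) mn Zm; rewrite Zk.
rewrite ltnNge; apply/negP => mn.
by have := absorb m n _ (or_intror erefl) mn Zm; rewrite Zk.
Qed.

Section Moments.
Context {d : measure_display} {T : measurableType d} {R : realType}.
Variables (P : probability T R) (f : nat -> nat -> R).
Variable X : nat -> nat -> {RV P >-> natD}.
Hypotheses (f_distr : forall n, (0 < n)%N -> defective_distribution (f n))
  (f_mean : forall n, (0 < n)%N -> (0 < mean (f n) < +oo)%E)
  (X_offspring : offspring_variables f X).

Let Z := GW (fun n j => X n j).

Let f_fin n : (0 < n)%N -> (mean (f n) < +oo)%E.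
Proof. by move=> /f_mean/andP[]. Qed.

Lemma expect_GW n : expectD P (Z n) (fun k => k%:R) [set: nat] =
  (\prod_(1 <= i < n.+1) dgenf (f i) (comp_genf f i (n - i) 1))%:E.
Proof.
rewrite expectD_series//; last by move=> k; exact: measurable_GW_eq X_offspring n k.
rewrite -(GW_dgenf f_distr f_fin X_offspring n); last by rewrite ler01 lexx.
apply: eq_eseriesr => k _; rewrite expr1n mulr1; congr (_ * P _)%E.
by apply/seteqP; split=> w // [].
Qed.

Lemma survival_GW n : P [set w | (n%:R%:E < @absorption_time T R Z w)%E] =
  (comp_genf f 0 n 1 - comp_genf f 0 n 0)%:E.
Proof.
have mZ k : measurable [set w | Z n w = Some k].
  exact: measurable_GW_eq X_offspring n k.
have -> : [set w | (n%:R%:E < @absorption_time T R Z w)%E] =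
    \bigcup_k [set w | Z n w = Some k.+1].
  apply/seteqP; split=> w /=; first by move=> /ltn_absorption_time[k Zk]; exists k.
  by move=> [k _ Zk]; apply/ltn_absorption_time; exists k.
rewrite measure_semi_bigcup//; last 2 first.
- by move=> i j _ _ [w /= [-> []]].
- exact: bigcup_measurable.
have p0 k : (0 <= P [set w | Z n w = Some k])%E by exact: measure_ge0.
have G1 := GW_genf f_distr X_offspring n (s := 1).
have G0 := GW_genf f_distr X_offspring n (s := 0).
rewrite lexx ler01 in G0; rewrite lexx ler01 in G1.
rewrite EFinB -G1// -G0//.
have -> : (\sum_(0 <= k <oo) (1 ^+ k)%:E * P [set w | Z n w = Some k] =
   P [set w | Z n w = Some 0%N] + \sum_(0 <= k <oo) P [set w | Z n w = Some k.+1])%E.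
  rewrite (nneseries_split 0 1) => [|k _]; last by rewrite mule_ge0// lee_fin exprn_ge0.
  rewrite add0n big_nat1 expr0 mul1e; congr (_ + _)%E.
  rewrite -nneseries_addn => [|k]; last by rewrite mule_ge0// lee_fin exprn_ge0.
  by apply: eq_eseriesr => k _; rewrite expr1n mul1e addn1.
(* By 0^0 = 1 the generating function at 0 is the mass at 0; mass at Delta enters neither series. *)
have -> : (\sum_(0 <= k <oo) (0 ^+ k)%:E * P [set w | Z n w = Some k] =
   P [set w | Z n w = Some 0%N])%E.
  rewrite (nneseries_split 0 1) => [|k _]; last by rewrite mule_ge0// lee_fin exprn_ge0.
  rewrite add0n big_nat1 expr0 mul1e eseries0 ?adde0// => k k1 _.
  by rewrite expr0n gtn_eqF// mul0e.
by rewrite addeAC subee ?add0e// fin_num_measure.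
Qed.

Lemma moment_regular_law (c : R) : 0 < c -> (forall n, (0 < n)%N ->
    (expectD P (X n 1%N) (fun k => (k%:R ^+ 2)%R) [set k | (2 <= k)%N] <=
     c%:E * expectD P (X n 1%N) (fun k => k%:R%R) [set k | (2 <= k)%N])%E) ->
  exists2 M, (0 < M)%N & forall n, (0 < n)%N -> regular_law M (f n).
Proof.
move=> c0 Hc; exists (Num.bound c).
  by rewrite -(ltr0n R); apply: lt_trans c0 (archi_boundP (ltW c0)).
move=> n n0; split; [exact: f_distr|exact: f_mean|].
set M := Num.bound c; have cM : c <= M%:R := ltW (archi_boundP (ltW c0)).
have f0 k : 0 <= f n k by case: (f_distr n0).
have [_ XE _] := X_offspring.
have E (h : nat -> R) : (forall k, 0 <= h k) ->
    expectD P (X n 1%N) h [set k | (2 <= k)%N] =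
    (\sum_(0 <= k <oo) (f n k * ((1 < k)%:R * h k))%:E)%E.
  move=> h0; rewrite expectD_series//; last first.
    move=> k; rewrite (_ : [set w | _] = X n 1%N @^-1` [set Some k])//.
    by rewrite -[X in measurable X]setTI; exact: measurable_funPT.
  apply: eq_eseriesr => k _; have [k1|k1] := ltnP 1 k.
    rewrite mul1r [RHS]EFinM muleC -(XE n 1%N)//; congr (P _ * _)%E.
    by apply/seteqP; split=> w // [].
  rewrite mul0r mulr0 (_ : [set w | _] = set0) ?measure0 ?mule0//.
  by apply/seteqP; split=> w // [_] /=; rewrite ltnNge k1.
have := Hc n n0; rewrite (E _ (fun k => ler0n R k)).
rewrite (E _ (fun k => exprn_ge0 2 (ler0n R k))).
have o01 : 0 <= (1 : R) <= 1 by rewrite ler01 lexx.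
have [W HW] : exists W, wsum (f n) (fun k => (1 < k)%:R * k%:R) W.
  apply: (wsum_dominated f0 _ (wsum_dgenf (f_distr n0) (f_fin n0) o01)) => k.
  by rewrite expr1n mulr1 mulr_ge0//= ler_piMl// lern1 leq_b1.
rewrite (nneseries_wsum _ HW) => [le2|k]; last by rewrite !mulr_ge0.
(* The second moment on {X >= 2} is finite because the moment condition bounds it by the finite
   first moment W. *)
have [||V HV VE] := @wsum_nneseries _ (f n) (fun k => (1 < k)%:R * k%:R ^+ 2).
- by move=> k; rewrite !mulr_ge0// sqr_ge0.
- by apply: (le_lt_trans le2); rewrite -EFinM ltry.
exists (1 * V + (- M%:R) * W).
  move: le2; rewrite VE -EFinM lee_fin => le2.
  rewrite mul1r mulNr subr_le0; apply: (le_trans le2); rewrite ler_wpM2r//.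
  have := le_wsum f0 (wsum_lin 0 0 HW HW) HW; rewrite !mul0r addr0; apply => k.
  by rewrite !mul0r addr0 mulr_ge0.
by apply: wsum_ext (wsum_lin _ _ HV HW) => k; ring.
Qed.

End Moments.

Lemma limn_einf_gt0 (R : realType) (u : nat -> \bar R) (c : R) (N : nat) :
  0 < c -> (forall n, (N <= n)%N -> (c%:E <= u n)%E) -> (0 < limn_einf u)%E.
Proof.
move=> c0 H; apply: (@lt_le_trans _ _ c%:E); first by rewrite lte_fin.
rewrite limn_einf_lim; apply: lime_ge; first exact: is_cvg_einfs.
exists N => // n /= Nn; apply: le_ereal_inf_tmp => _ [m /= nm <-].
by apply: H; exact: leq_trans nm.
Qed.

Lemma limn_esup_lty (R : realType) (u : nat -> \bar R) (C : R) :
  (forall n, (u n <= C%:E)%E) -> (limn_esup u < +oo)%E.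
Proof.
move=> H; apply: (@le_lt_trans _ _ C%:E); last exact: ltry.
rewrite limn_esup_lim; apply: lime_le; first exact: is_cvg_esups.
by exists 0%N => // n /= _; apply: ge_ereal_sup => _ [m /= nm <-]; exact: H.
Qed.

Lemma ereal_inf_gt0_bound (R : realType) (g : nat -> R) :
  (0 < ereal_inf [set (g n)%:E | n in [set n | (0 < n)%N]])%E ->
  exists2 e, 0 < e & forall n, (0 < n)%N -> e <= g n.
Proof.
set s := ereal_inf _ => s0.
have le n : (0 < n)%N -> (s <= (g n)%:E)%E.
  by move=> n0; apply: ereal_inf_lbound; exists n.
have sf : s \is a fin_num.
  by rewrite ge0_fin_numE ?(ltW s0)//; apply: le_lt_trans (le 1%N isT) (ltry _).
exists (fine s); first by rewrite -lte_fin fineK.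
by move=> n n0; rewrite -lee_fin fineK// le.
Qed.

Theorem theorem3 (R : realType) (d : measure_display) (T : measurableType d)
    (P : probability T R) (f : nat -> nat -> R)
    (X : nat -> nat -> {RV P >-> natD})
    (f_distr : forall n, (0 < n)%N -> defective_distribution (f n))
    (f_mean : forall n, (0 < n)%N -> (0 < mean (f n) < +oo)%E)
    (X_offspring : offspring_variables f X)
    (X_moment : exists2 c : R, 0 < c & forall n, (0 < n)%N ->
      (expectD P (X n 1%N) (fun k => (k%:R ^+ 2)%R) [set k | (2 <= k)%N] <=
       c%:E * expectD P (X n 1%N) (fun k => k%:R%R) [set k | (2 <= k)%N])%E)
    (rho : R) (rho01 : 0 < rho < 1) (n0 : nat) (n0_gt0 : (0 < n0)%N)
    (f_rho : forall n, (n0 <= n)%N -> rho <= genf (f n) rho) :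
  let Z := GW (fun n j => X n j) in
  let EZ := fun n => expectD P (Z n) (fun k => k%:R%R) [set: nat] in
  let survival := fun n =>
    P [set w | (n%:R%:E < @absorption_time T R Z w)%E] in
  ((0 < limn_einf (fun n => EZ n * ((mu f n rho)^-1)%:E))%E /\
   (0 < limn_einf (fun n => (nu f n rho)%:E * survival n))%E) /\
  ((0 < ereal_inf [set (delta f n)%:E | n in [set n | (0 < n)%N]])%E ->
   (0 < ereal_inf [set (d2genf (f n) rho)%:E | n in [set n | (0 < n)%N]])%E ->
   forall sigma : R, rho < sigma < 1 ->
   (forall n, (n0 <= n)%N -> genf (f n) sigma <= sigma) ->
   forall eps : R, 0 < eps -> sigma + eps <= 1 ->
   (limn_esup (fun n => EZ n * ((mu f n (sigma + eps))^-1)%:E) < +oo)%E /\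
   (limn_esup (fun n => (nu f n (sigma + eps))%:E * survival n) < +oo)%E).
Proof.
have [c c0 Hc] := X_moment.
have [M M0 f_reg] := moment_regular_law f_distr f_mean X_offspring c0 Hc.
move=> Z EZ survival.
have EZE n : EZ n = (\prod_(1 <= i < n.+1) dgenf (f i) (comp_genf f i (n - i) 1))%:E.
  exact: expect_GW.
have SE n : survival n = (comp_genf f 0 n 1 - comp_genf f 0 n 0)%:E.
  exact: survival_GW.
split; first split.
- have [a a0 Ha] := mean_bound_below M0 f_reg rho01 f_rho.
  by apply: (limn_einf_gt0 (N := 0%N) a0) => n _; rewrite EZE -EFinM lee_fin.
- have [a a0 Ha] := survival_bound_below M0 f_reg rho01 f_rho.
  (* [nu f 0 rho] is an empty sum, so the bound can only start at n = 1. *)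
  by apply: (limn_einf_gt0 (N := 1%N) a0) => n n1; rewrite SE -EFinM lee_fin Ha.
move=> /ereal_inf_gt0_bound[dl dl0 Hdl] /ereal_inf_gt0_bound[eta eta0 Heta].
move=> sigma sigma01 f_sigma eps eps0 sigma_eps.
have f_dl n : (0 < n)%N -> genf (f n) 1 <= 1 - dl.
  by move=> /Hdl; rewrite /delta; lra.
split.
- have [C HC] := mean_bound_above M0 f_reg rho01 dl0 f_dl sigma01 f_sigma eps0 sigma_eps.
  by apply: (limn_esup_lty (C := C)) => n; rewrite EZE -EFinM lee_fin.
- have [C HC] := survival_bound_above M0 f_reg rho01 f_rho dl0 f_dl eta0 Heta
    sigma01 f_sigma eps0 sigma_eps.
  by apply: (limn_esup_lty (C := C)) => n; rewrite SE -EFinM lee_fin.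
Qed.
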